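(* Let $a, b > 0$ and $\lambda, \mu \in \mathbb{R}$. For every integer $n \geq 0$, $$\int_{\mathbb{R}} e^{-i\mu t}\, t^n\, \Gamma(a+it)\, \Gamma(b-it)\, dt = i^n\, 2\pi\, e^{-b\mu} \sum_{k=0}^n \sum_{m=0}^k \binom{n}{k} \left\{{k \atop m}\right\} (-1)^m a^{n-k}\, \frac{\Gamma(a+b+m)}{(1+e^{-\mu})^{a+b+m}}$$ and $$\int_{\mathbb{R}} e^{-i\lambda t}\, t^n\, \Gamma(a+it)\, dt = i^n\, 2\pi\, e^{a\lambda} e^{-e^\lambda} \sum_{k=0}^n \binom{n}{k} a^{n-k} \sum_{m=0}^k \left\{{k \atop m}\right\} (-1)^m e^{\lambda m}.$$ In particular (for $\lambda=\mu=0$), $$\int_{\mathbb{R}} t^n\, \Gamma(a+it)\,\Gamma(b-it)\, dt = i^n \pi \sum_{k=0}^n \sum_{m=0}^k \binom{n}{k} \left\{{k \atop m}\right\} (-1)^m a^{n-k}\, \frac{\Gamma(a+b+m)}{2^{a+b+m-1}}$$ and $$\int_{\mathbb{R}} t^n\, \Gamma(a+it)\, dt = \frac{2\pi i^n}{e} \sum_{k=0}^n \sum_{m=0}^k \binom{n}{k} \left\{{k \atop m}\right\} (-1)^m a^{n-k}.$$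
   Context: $\Gamma$ is the Euler Gamma function, $\Gamma(z)=\int_0^\infty x^{z-1}e^{-x}\,dx$ for $\operatorname{Re} z>0$; $i$ is the imaginary unit. $\left\{{k \atop m}\right\}$ denotes the Stirling number of the second kind, i.e. the number of partitions of a set of $k$ elements into $m$ nonempty subsets, with $\left\{{0 \atop 0}\right\}=1$ and $\left\{{k \atop 0}\right\}=0$ for $k\geq 1$. *)

(* Defs.v *)
From HB Require Import structures.
From mathcomp Require Import all_boot all_order all_algebra.
From mathcomp Require Import all_classical all_reals all_analysis.
From mathcomp.real_closed Require Import complex.

Set Implicit Arguments.
Unset Strict Implicit.
Unset Printing Implicit Defensive.

Import Order.TTheory GRing.Theory Num.Theory.
Import numFieldNormedType.Exports.

Local Open Scope classical_set_scope.
Local Open Scope ring_scope.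
Local Open Scope complex_scope.

Definition expC (R : realType) (z : R[i]) : R[i] :=
  (expR (complex.Re z))%:C *
  (cos (complex.Im z) +i* sin (complex.Im z)).

Definition integrableC (R : realType) (D : set R) (f : R -> R[i]) : Prop :=
  (@lebesgue_measure R).-integrable D (fun x => (complex.Re (f x))%:E) /\
  (@lebesgue_measure R).-integrable D (fun x => (complex.Im (f x))%:E).

(* Total; it is the Lebesgue integral of f over D only under [integrableC D f]
   ([Rintegral] sends infinite integrals to 0). *)
Definition integralC (R : realType) (D : set R) (f : R -> R[i]) : R[i] :=
  Rintegral (@lebesgue_measure R) D (fun x => complex.Re (f x)) +i*
  Rintegral (@lebesgue_measure R) D (fun x => complex.Im (f x)).

Definition has_integralC (R : realType) (D : set R) (f : R -> R[i])
    (v : R[i]) : Prop :=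
  integrableC D f /\ integralC D f = v.

(* Euler's integral, x ^ (z - 1) being exp ((z - 1) ln x); it is the Gamma
   function on Re z > 0 only (no analytic continuation). *)
Definition GammaC (R : realType) (z : R[i]) : R[i] :=
  integralC `]0%R, +oo[
    (fun x : R => expC ((z - 1) * (ln x)%:C) * (expR (- x))%:C).

Definition stirling2 (k m : nat) : nat :=
  #|[set P : {set {set 'I_k}} | finset.partition P [set: 'I_k]%SET
                                & #|P| == m]%SET|.

Lemma stirling2_00 : stirling2 0 0 = 1%N.
Proof.
rewrite /stirling2 -(cards1 (finset.set0 : {set {set 'I_0}})).
apply: eq_card => P; rewrite !inE cards_eq0.
case: eqP => [->|_]; rewrite ?andbF //= andbT.
apply/and3P; split; rewrite ?finset.in_set0 //.
  by apply/eqP/setP=> -[].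
by apply/finset.trivIsetP => A B; rewrite finset.in_set0.
Qed.

Lemma stirling2_S0 (k : nat) : stirling2 k.+1 0 = 0%N.
Proof.
apply: eq_card0 => P; rewrite !inE cards_eq0.
case: eqP => [->|_]; rewrite ?andbF //= andbT.
apply/negP => /and3P[/eqP/setP/(_ ord0)].
by rewrite /finset.cover big_set0 !inE.
Qed.

(* Main.v *)
Require Import Defs.
From mathcomp Require Import all_boot all_order all_algebra.
From mathcomp Require Import all_classical all_reals all_analysis.
From mathcomp Require Import measurable_realfun.
From mathcomp.real_closed Require Import complex.
From mathcomp Require Import ring lra.
Import Order.TTheory GRing.Theory Num.Theory.
Import numFieldNormedType.Exports.

(** Substituting x = e^s in Euler's integral shows that t |-> Gamma(a + it) is
    the Fourier transform, with kernel e^(its), of the function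
    g(s) = e^(as - e^s) ([GammaC_fourier]).  Likewise
    Gamma(a + it) Gamma(b - it) is the transform of the cross-correlation of two
    such functions, and a translation evaluates that correlation in closed form,
    Gamma(a + b) e^(as) / (1 + e^s)^(a + b) ([beta_densityE],
    [GammaC_mul_fourier]).

    For any smooth g whose derivatives all decay exponentially, multiplying the
    transform by t^n amounts to replacing g by i^n times its n-th derivative,
    and multiplying it by e^(-ilt) amounts to translating g by l.  So the
    moments are i^n times the integral of the transform of a translated
    derivative, and Fourier inversion at the origin gives
    2 pi i^n g^(n)(l) ([fourier_moment]).

    Inversion at the origin is Abel summation.  With the damping factor
    e^(-e|t|), Fubini turns the integral of the transform of h into the integral
    of h against the Poisson kernel 2e / (e^2 + s^2) ([poisson_kernel]).  That
    kernel is the derivative of 2 atan(s / e), so one integration by parts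
    leaves - h' times a bounded function tending to pi sgn(s), and dominated
    convergence gives 2 pi h(0) ([integral_fcos]).  Undamping on the other side
    is legitimate because the transform of h is O(1 / t^2).

    Finally both functions g belong to a sequence phi_0 = g, phi_1, ... with
    phi_m' = (a + m) phi_m - phi_(m+1).  By this single rule, by the recurrence
    of the Stirling numbers and by Pascal's rule, the n-th derivative of phi_0
    is the double sum of the statement ([is_derive_leibniz_sum]).  The
    recurrence itself comes from counting functions between finite sets
    according to the partition into fibres that they induce
    ([sum_stirling2_ffact], [stirling2_rec]). *)

Set Implicit Arguments.
Unset Strict Implicit.

Local Open Scope classical_set_scope.
Local Open Scope ring_scope.

(** * Integration on the real line *)

Section dominated.
Context d (T : measurableType d) (R : realType).
Variable m : {measure set T -> \bar R}.

Lemma integrable_le (D : set T) (f g : T -> R) :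
  measurable D -> measurable_fun D f ->
  (forall x, D x -> `|f x| <= g x) ->
  m.-integrable D (EFin \o g) -> m.-integrable D (EFin \o f).
Proof.
move=> mD mf fg; apply: le_integrable => //; first exact/measurable_EFinP.
by move=> x Dx /=; rewrite lee_fin (le_trans (fg _ Dx)) ?ler_norm.
Qed.

Lemma measurable_pointwise_limit (D : set T) (f_ : nat -> T -> R) (f : T -> R) :
  measurable D -> (forall n, measurable_fun D (f_ n)) ->
  (forall x, D x -> f_ n x @[n --> \oo] --> f x) -> measurable_fun D f.
Proof.
move=> mD mf_ f_f; apply/measurable_EFinP.
apply: (emeasurable_fun_cvg (fun n x => (f_ n x)%:E)) => //.
- by move=> n; exact/measurable_EFinP.
- by move=> x Dx; apply: cvg_EFin; [exact: nearW|exact: f_f].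
Qed.

Lemma cvg_Rintegral_dominated (D : set T) (f_ : nat -> T -> R) (f g : T -> R) :
  measurable D -> (forall n, measurable_fun D (f_ n)) ->
  (forall x, D x -> f_ n x @[n --> \oo] --> f x) ->
  m.-integrable D (EFin \o g) ->
  (forall n x, D x -> `|f_ n x| <= g x) ->
  \int[m]_(x in D) f_ n x @[n --> \oo] --> \int[m]_(x in D) f x.
Proof.
move=> mD mf_ f_f ig f_g.
have mf := measurable_pointwise_limit mD mf_ f_f.
have [intf _ h] : [/\ m.-integrable D (EFin \o f),
    [sequence (\int[m]_(x in D) `|(f_ n x)%:E - (f x)%:E|)%E]_n @ \oo --> 0%E &
    [sequence (\int[m]_(x in D) (f_ n x)%:E)%E]_n @ \oo -->
      (\int[m]_(x in D) (f x)%:E)%E].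
  apply: (@dominated_convergence _ _ _ m D mD (fun n x => (f_ n x)%:E) _ (EFin \o g)) => //.
  - by move=> n; exact/measurable_EFinP.
  - exact/measurable_EFinP.
  - by apply: aeW => x Dx; apply: cvg_EFin; [exact: nearW|exact: f_f].
  - by apply: aeW => x n Dx; rewrite lee_fin; exact: f_g.
apply: fine_cvg; rewrite fineK//.
exact: integrable_fin_num.
Qed.

End dominated.

Section lebesgue_line.
Context (R : realType).
Local Notation mu := (@lebesgue_measure R).
Implicit Types f g F : R -> R.

(** Half-open intervals determine the measure, and translating one preserves its
    length. *)
Lemma lebesgue_measureD (c : R) (A : set R) : measurable A ->
  pushforward mu (+%R^~ c : _ -> measurableTypeR R) A = mu A.
Proof.
move=> mA; apply/esym/lebesgue_measure_unique => //=.
  by apply: (@measurable_funD _ _ _ setT id (cst c)) => //; exact: measurable_cst.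
move=> ms _ [[a b]] _ <-.
rewrite /pushforward.
have -> : (+%R^~ c) @^-1` `]a, b] = `]a - c, b - c]%classic :> set R.
  by apply/seteqP; split=> x /=; rewrite !in_itv/= ltrBlDr lerBrDr.
rewrite !lebesgue_measure_itv/= !lte_fin ltrD2r -!EFinB.
by have -> : b - c - (a - c) = b - a by ring.
Qed.

Lemma integral_invariant (phi : R -> measurableTypeR R) f :
  measurable_fun [set: R] phi ->
  (forall A, measurable A -> pushforward mu phi A = mu A) ->
  mu.-integrable setT (EFin \o f) ->
  mu.-integrable setT (EFin \o (f \o phi)) /\
  \int[mu]_x f (phi x) = \int[mu]_x f x.
Proof.
move=> mphi mu_phi intf; have mf := measurable_int _ intf.
have pushE (g : R -> \bar R) :
    (\int[mu]_x g x = \int[pushforward mu phi]_x g x)%E.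
  by apply: eq_measure_integral => A mA _; have /= := mu_phi A mA.
have ints : mu.-integrable setT (EFin \o (f \o phi)).
  apply/integrableP; split; first exact: measurableT_comp mf mphi.
  case/integrableP: (intf) => _; apply: le_lt_trans.
  rewrite [leRHS]pushE ge0_integral_pushforward//.
  by apply: measurableT_comp.
by split=> //; congr fine; rewrite [RHS]pushE integral_pushforward.
Qed.

Lemma integral_shift f c : mu.-integrable setT (EFin \o f) ->
  mu.-integrable setT (fun x => (f (x + c))%:E) /\
  \int[mu]_x f (x + c) = \int[mu]_x f x.
Proof.
apply: (integral_invariant (phi := +%R^~ c)); last exact: lebesgue_measureD.
by apply: (@measurable_funD _ _ _ setT id (cst c)) => //; exact: measurable_cst.
Qed.

Lemma integral_reflect f : mu.-integrable setT (EFin \o f) ->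
  mu.-integrable setT (fun x => (f (- x))%:E) /\
  \int[mu]_x f (- x) = \int[mu]_x f x.
Proof.
apply: (integral_invariant (phi := -%R)); last exact: lebesgue_measureN.
exact: oppr_measurable.
Qed.

Lemma integral_odd f : mu.-integrable setT (EFin \o f) ->
  (forall x, f (- x) = - f x) -> \int[mu]_x f x = 0.
Proof.
move=> intf oddf; have [_ h] := integral_reflect intf.
have : \int[mu]_x f x = - \int[mu]_x f x.
  rewrite -{1}h (_ : (fun x => f (- x)) = (fun x => -1 * f x)); last first.
    by apply/funext => x; rewrite oddf mulN1r.
  by rewrite RintegralZl// mulN1r.
lra.
Qed.

(** Dominated convergence for f times the indicators of the E_ n.  This carries
    the fundamental theorem of calculus and a change of variables from segments
    to unbounded domains with no sign condition on f. *)
Lemma cvg_Rintegral_exhaust (D : set R) (E_ : nat -> set R) f :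
  measurable D -> (forall n, measurable (E_ n)) ->
  (forall n, E_ n `<=` D) -> (forall x, D x -> \forall n \near \oo, E_ n x) ->
  mu.-integrable D (EFin \o f) ->
  \int[mu]_(x in E_ n) f x @[n --> \oo] --> \int[mu]_(x in D) f x.
Proof.
move=> mD mE ED Ecvg intf.
have mf : measurable_fun D f by apply/measurable_EFinP; exact: measurable_int intf.
under eq_fun => n.
  have -> : E_ n = D `&` E_ n by apply/seteqP; split=> x; [split=> //; exact: (ED n)|case].
  rewrite Rintegral_mkcondr. over.
apply: (@cvg_Rintegral_dominated _ _ _ mu D (fun n => f \_ (E_ n)) f (fun x => `|f x|)) => //.
- move=> n; apply/measurable_restrict => //.
    exact: mE.
  by apply: measurable_funS mD _ mf; exact: subIsetl.
- move=> x Dx; apply: cvg_near_cst.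
  by near=> n; rewrite patchE mem_set//; near: n; exact: Ecvg.
- exact: integrable_norm.
- by move=> n x _; rewrite patchE; case: ifP => // _; rewrite normr0.
Unshelve. all: by end_near. Qed.

Lemma integral_FTC2 f F (a b : R) : a < b -> continuous f ->
  (forall x : R, is_derive x 1 F (f x)) -> \int[mu]_(x in `[a, b]) f x = F b - F a.
Proof.
move=> ab cf dF; rewrite /Rintegral (@continuous_FTC2 _ f F)//.
- by apply: continuous_subspaceT => x; exact: cf.
- have cF : continuous F.
    by move=> x; apply/differentiable_continuous/derivable1_diffP; exact: ex_derive.
  split=> [x _||]; first exact: ex_derive.
    exact/cvg_at_right_filter/cF.
  exact/cvg_at_left_filter/cF.
- by move=> x _; rewrite derive1E derive_val.
Qed.

Lemma integral_FTC2_exhaust f F (D : set R) (u_ v_ : nat -> R) (l : R) :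
  measurable D -> (forall n, u_ n < v_ n) ->
  (forall n, `[u_ n, v_ n] `<=` D) ->
  (forall x, D x -> \forall n \near \oo, u_ n <= x <= v_ n) ->
  continuous f -> (forall x : R, is_derive x 1 F (f x)) ->
  mu.-integrable D (EFin \o f) ->
  F (v_ n) - F (u_ n) @[n --> \oo] --> l ->
  \int[mu]_(x in D) f x = l.
Proof.
move=> mD uv uvD Duv cf dF intf Fl.
suff h : \int[mu]_(x in `[u_ n, v_ n]) f x @[n --> \oo] --> \int[mu]_(x in D) f x.
  move: h; under eq_fun do rewrite (integral_FTC2 (uv _) cf dF).
  by move/cvg_unique; apply.
exact: cvg_Rintegral_exhaust.
Qed.

Lemma cvgn_natSr : n.+1%:R @[n --> \oo] --> (+oo : set_system R).
Proof. by rewrite (cvg_shiftS (fun n => n%:R : R)); exact: cvgr_idn. Qed.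

Lemma integral_FTC2T f F (l l' : R) : continuous f ->
  (forall x : R, is_derive x 1 F (f x)) -> mu.-integrable setT (EFin \o f) ->
  F x @[x --> -oo] --> l -> F x @[x --> +oo] --> l' ->
  \int[mu]_x f x = l' - l.
Proof.
move=> cf dF intf Fl Fl'.
apply: (@integral_FTC2_exhaust f F _ (fun n => - n.+1%:R) (fun n => n.+1%:R)) => //.
- by move=> n; rewrite gtrN.
- move=> x _; near=> n; rewrite -ler_norml.
  rewrite (le_trans _ (_ : n%:R <= _)) ?ler_nat//.
  by near: n; exact: nbhs_infty_ger.
- apply: cvgB; first exact: cvg_comp cvgn_natSr Fl'.
  by apply: cvg_comp Fl; apply/cvgNrNy; exact: cvgn_natSr.
Unshelve. all: by end_near. Qed.

Lemma integral_FTC2y f F (a l : R) : continuous f ->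
  (forall x : R, is_derive x 1 F (f x)) -> mu.-integrable `[a, +oo[ (EFin \o f) ->
  F x @[x --> +oo] --> l ->
  \int[mu]_(x in `[a, +oo[) f x = l - F a.
Proof.
move=> cf dF intf Fl.
apply: (@integral_FTC2_exhaust f F _ (fun=> a) (fun n => a + n.+1%:R)) => //.
- by move=> n; rewrite ltrDl.
- by move=> n x /=; rewrite !in_itv/= => /andP[->].
- move=> x /=; rewrite in_itv/= => /andP[ax _]; near=> n.
  rewrite ax/= -lerBlDl (le_trans _ (_ : n%:R <= _)) ?ler_nat//.
  by near: n; exact: nbhs_infty_ger.
- apply: cvgB; last exact: cvg_cst.
  by apply: cvg_comp Fl; apply: cvg_comp cvgn_natSr (cvg_addrl a).
Unshelve. all: by end_near. Qed.

Lemma integral_FTC2Ny f F (a l : R) : continuous f ->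
  (forall x : R, is_derive x 1 F (f x)) -> mu.-integrable `]-oo, a] (EFin \o f) ->
  F x @[x --> -oo] --> l ->
  \int[mu]_(x in `]-oo, a]) f x = F a - l.
Proof.
move=> cf dF intf Fl.
apply: (@integral_FTC2_exhaust f F _ (fun n => a - n.+1%:R) (fun=> a)) => //.
- by move=> n; rewrite gtrBl.
- by move=> n x /=; rewrite !in_itv/= => /andP[_ ->].
- move=> x /=; rewrite in_itv/= => xa; near=> n.
  rewrite xa/= andbT lerBlDr -lerBlDl (le_trans _ (_ : n%:R <= _)) ?ler_nat//.
  by near: n; exact: nbhs_infty_ger.
- apply: cvgB; first exact: cvg_cst.
  apply: cvg_comp Fl; apply: cvg_comp (cvg_addrl_Ny a).
  by apply/cvgNrNy; exact: cvgn_natSr.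
Unshelve. all: by end_near. Qed.

(** Decay at both ends of the line: it gives integrability and vanishing limits
    at once, and is stable under linear combinations and translations. *)
Definition expdecay f :=
  exists K c : R, 0 < c /\ forall x, `|f x| <= K * expR (- (c * `|x|)).

Lemma is_derive_expRZ (c x : R) : is_derive x 1 (fun y => expR (c * y)) (c * expR (c * x)).
Proof. by apply: is_derive_eq; rewrite /GRing.scale/= mulr1 mulrC. Qed.

Lemma cvgy_expRN (c : R) : 0 < c -> expR (- (c * x)) @[x --> +oo] --> (0 : R).
Proof.
move=> c0; apply: (@cvg_comp _ _ _ ( *%R c) (fun y => expR (- y))); last exact: cvgr_expR.
exact: gt0_cvgMry.
Qed.

Lemma integrable_expRNnorm (c : R) : 0 < c ->
  mu.-integrable setT (fun x => (expR (- (c * `|x|)))%:E).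
Proof.
move=> c0.
have cexp : continuous (fun x : R => expR (- (c * `|x|))).
  move=> x; apply: continuous_comp; last exact: continuous_expR.
  apply: cvgN; apply: cvgM; [exact: cvg_cst|exact: norm_continuous].
have mexp : measurable_fun setT (fun x : R => expR (- (c * `|x|))).
  exact: continuous_measurable_fun.
apply/integrableP; split; first exact/measurable_EFinP.
under eq_integral do rewrite /= ger0_norm ?expR_ge0//.
rewrite (@ge0_symfun_integralT R (fun x => expR (- (c * `|x|))))//; last first.
  by move=> x /=; rewrite normrN.
rewrite -set_itvcy.
have -> : (\int[mu]_(x in `[0%R, +oo[) (expR (- (c * `|x|)))%:E =
    \int[mu]_(x in `[0%R, +oo[) (expR (- c * x))%:E)%E.
  apply: eq_integral => x; rewrite inE/= in_itv/= andbT => x0.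
  by rewrite ger0_norm// mulNr.
have dF (x : R) : is_derive x 1 (fun x => - c^-1 * expR (- c * x)) (expR (- c * x)).
  have := is_derive_expRZ (- c) x => h.
  apply: is_derive_eq; rewrite /GRing.scale/=.
  field; lra.
have c1 : continuous (fun x : R => expR (- c * x)).
  move=> x; apply: continuous_comp; last exact: continuous_expR.
  by apply: cvgM; [exact: cvg_cst|exact: cvg_id].
rewrite (@ge0_continuous_FTC2y _ _ (fun x => - c^-1 * expR (- c * x)) 0 0)//.
- by rewrite -EFinB -EFinM ltry.
- exact: continuous_subspaceT.
- rewrite -[X in _ --> X](mulr0 (- c^-1)); apply: cvgM; first exact: cvg_cst.
  by under eq_fun do rewrite mulNr; exact: cvgy_expRN.
- apply: cvgM; first exact: cvg_cst.
  by apply: cvg_at_right_filter; exact: c1.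
- by move=> x _; rewrite derive1E derive_val.
Qed.

Lemma expdecay_integrable f : measurable_fun setT f -> expdecay f ->
  mu.-integrable setT (EFin \o f).
Proof.
move=> mf [K [c [c0 fK]]].
apply: (@integrable_le _ _ _ mu setT f (fun x => K * expR (- (c * `|x|)))) => //.
exact: (integrableZl _ K (integrable_expRNnorm c0)).
Qed.

Lemma expdecay_cvgy f : expdecay f -> f x @[x --> +oo] --> (0 : R).
Proof.
move=> [K [c [c0 fK]]]; apply: norm_cvg0.
have h : K * expR (- (c * x)) @[x --> +oo] --> (0 : R).
  rewrite -[X in _ --> X](mulr0 K); apply: cvgM; first exact: cvg_cst.
  exact: cvgy_expRN.
apply: (squeeze_cvgr _ (cvg_cst 0) h); near=> x.
rewrite normr_ge0/= (le_trans (fK x))// ger0_norm//.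
Unshelve. all: by end_near. Qed.

Lemma expdecay_reflect f : expdecay f -> expdecay (fun x => f (- x)).
Proof.
by move=> [K [c [c0 fK]]]; exists K, c; split=> // x; have := fK (- x); rewrite normrN.
Qed.

Lemma expdecay_cvgNy f : expdecay f -> f x @[x --> -oo] --> (0 : R).
Proof.
by move=> /expdecay_reflect/expdecay_cvgy h; apply/cvgNy_compNP.
Qed.

(** The substitution is made on the segments [-n, n] and passed to the limit.
    Monotone convergence, applied to |G| first, supplies the integrability of G
    that the limit of the signed integrals needs. *)
Lemma integral_subst_expR (G : R -> R) :
  {in `]0, +oo[%R, continuous G} ->
  mu.-integrable setT (EFin \o (fun s => G (expR s) * expR s)) ->
  mu.-integrable `]0%R, +oo[ (EFin \o G) /\
  \int[mu]_(x in `]0, +oo[) G x = \int[mu]_s (G (expR s) * expR s).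
Proof.
move=> cG intf.
pose E_ n : set R := `[expR (- n.+1%:R), expR n.+1%:R]%classic.
pose I_ n : set R := `[- n.+1%:R, n.+1%:R]%classic.
have E0 n : E_ n `<=` `]0, +oo[.
  move=> x /=; rewrite !in_itv/= andbT => /andP[h _].
  exact: lt_le_trans (expR_gt0 _) h.
have EP x : 0 < x -> \forall n \near \oo, E_ n x.
  move=> x0; near=> n; rewrite /E_ /= in_itv/= -[x]lnK// !ler_expR -ler_norml.
  rewrite (le_trans _ (_ : n%:R <= _)) ?ler_nat//.
  by near: n; exact: nbhs_infty_ger.
have IP x : \forall n \near \oo, I_ n x.
  near=> n; rewrite /I_ /= in_itv/= -ler_norml.
  rewrite (le_trans _ (_ : n%:R <= _)) ?ler_nat//.
  by near: n; exact: nbhs_infty_ger.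
have dexp : derive1 (@expR R) = @expR R.
  by apply/funext => x; rewrite derive1E derive_val.
have sub (H : R -> R) n : {in `]0, +oo[%R, continuous H} ->
    (\int[mu]_(x in E_ n) (H x)%:E =
     \int[mu]_(s in I_ n) (H (expR s) * expR s)%:E)%E.
  move=> cH; rewrite /E_ integration_by_substitution_increasing//.
  - apply: eq_integral => s _; congr EFin; rewrite !fctE.
    by rewrite derive1E derive_val.
  - by rewrite ltW// gtrN.
  - by move=> x y _ _ xy; rewrite ltr_expR.
  - rewrite dexp; move=> x _; exact: continuous_expR.
  - rewrite dexp; apply/cvg_ex; eexists; apply: cvg_at_right_filter; exact: continuous_expR.
  - rewrite dexp; apply/cvg_ex; eexists; apply: cvg_at_left_filter; exact: continuous_expR.
  - split=> //.
    + by apply: cvg_at_right_filter; exact: continuous_expR.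
    + by apply: cvg_at_left_filter; exact: continuous_expR.
  - apply: continuous_in_subspaceT => x; rewrite inE => /E0/= x0.
    exact: cH.
have cnG : {in `]0, +oo[%R, continuous (fun x => `|G x|)}.
  by move=> x /cG cGx; apply: cvg_norm.
have mG : measurable_fun (`]0, +oo[ : set R) G.
  by apply: open_continuous_measurable_fun => //; exact/in_continuous_mksetP.
have intG : mu.-integrable `]0%R, +oo[ (EFin \o G).
  apply/integrableP; split; first exact/measurable_EFinP.
  case/integrableP: (intf) => mf; apply: le_lt_trans.
  have bE : \bigcup_n E_ n = `]0%R, +oo[%classic.
    apply/seteqP; split=> [x [n _ /E0]//|x /= x0].
    have [n _ hn] : \forall n \near \oo, E_ n x by apply: EP; move: x0; rewrite in_itv/= andbT.
    by exists n => //; apply: hn => /=.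
  have h : (\int[mu]_(x in E_ n) `|(G x)%:E| @[n --> \oo] -->
      \int[mu]_(x in \bigcup_n E_ n) `|(G x)%:E|)%E.
    apply: (@ge0_nondecreasing_set_cvg_integral _ (measurableTypeR R)) => //.
    - move=> n k nk; apply/subsetPset => x; rewrite /E_ /= !in_itv/= => /andP[h1 h2].
      apply/andP; split.
        by apply: le_trans h1; rewrite ler_expR lerN2 ler_nat.
      by apply: le_trans h2 _; rewrite ler_expR ler_nat.
    - by move=> n; exact: measurable_itv.
    - move=> n.
      have mGn : measurable_fun (E_ n) G by apply: measurable_funS (@E0 n) mG.
      apply/measurable_EFinP; exact: measurableT_comp mGn.
  rewrite bE in h; rewrite -(cvg_lim _ h)//; apply: lime_le.
    by apply/cvg_ex; eexists; exact: h.
  apply: nearW => n; rewrite (sub (fun x => `|G x|))//.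
  rewrite (_ : (fun s => _%:E) = (fun s => `|((G (expR s)) * expR s)%:E|%E)).
    apply: ge0_subset_integral => //; first exact: measurable_itv.
    by apply: measurableT_comp mf.
  by apply/funext => x /=; rewrite normrM (ger0_norm (expR_ge0 _)).
split=> //.
have h1 : \int[mu]_(x in E_ n) G x @[n --> \oo] --> \int[mu]_(x in `]0, +oo[) G x.
  apply: cvg_Rintegral_exhaust => //; first by move=> n; exact: measurable_itv.
  by move=> x /=; rewrite in_itv/= andbT => /EP.
have h2 : \int[mu]_(x in E_ n) G x @[n --> \oo] --> \int[mu]_s (G (expR s) * expR s).
  rewrite (_ : (fun n => \int[mu]_(x in E_ n) G x) = (fun n => \int[mu]_(s in I_ n) (G (expR s) * expR s))).
    by apply: cvg_Rintegral_exhaust => // n; exact: measurable_itv.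
  by apply/funext => n; rewrite /Rintegral sub.
exact: cvg_unique h1 h2.
Unshelve. all: by end_near. Qed.

End lebesgue_line.

Section real_integrals.
Context (R : realType).
Local Notation mu := (@lebesgue_measure R).
Implicit Types f g h k F : R -> R.

Lemma integrable_measurable f (D : set R) :
  mu.-integrable D (EFin \o f) -> measurable_fun D f.
Proof. by move=> /measurable_int/measurable_EFinP. Qed.

Lemma integrable_mul_bounded h k (M : R) :
  mu.-integrable setT (EFin \o h) -> measurable_fun setT k ->
  (forall x, `|k x| <= M) ->
  mu.-integrable setT (EFin \o (fun x => h x * k x)).
Proof.
move=> ih mk kM.
apply: (@integrable_le _ _ _ mu setT _ (fun x => M * `|h x|)) => //.
- by apply: measurable_funM => //; exact: integrable_measurable.
- by move=> x _; rewrite normrM mulrC ler_wpM2r.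
- by apply: (integrableZl _ M (integrable_norm ih)).
Qed.

(** The majorant G gives integrability on the product.  Asking that every section
    be integrable, and not almost every one, lets each inner integral be read as
    a real number. *)
Lemma Rintegral_Fubini (f : R -> R -> R) (G : R -> R) :
  measurable_fun setT (fun z : measurableTypeR R * measurableTypeR R => f z.1 z.2) ->
  (forall x, mu.-integrable setT (EFin \o f x)) ->
  (forall y, mu.-integrable setT (EFin \o f^~ y)) ->
  (forall x, \int[mu]_y `|f x y| <= G x) -> mu.-integrable setT (EFin \o G) ->
  mu.-integrable setT (EFin \o (fun y => \int[mu]_x f x y)) /\
  \int[mu]_x \int[mu]_y f x y = \int[mu]_y \int[mu]_x f x y.
Proof.
move=> mf ifx ify fG iG.
(* The variables are exchanged so that the marginal proved integrable is the one
   in y. *)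
pose F (z : measurableTypeR R * measurableTypeR R) : \bar R := (f z.2 z.1)%:E.
have mF : measurable_fun setT F.
  apply/measurable_EFinP.
  have ms : measurable_fun setT
    (fun z : measurableTypeR R * measurableTypeR R => (z.2, z.1)).
    exact: measurable_fun_pair.
  have h := measurableT_comp mf ms.
  exact: h.
have EFx x : (\int[mu]_y (f x y)%:E = (\int[mu]_y f x y)%:E)%E.
  by rewrite fineK//; apply: integrable_fin_num => //; exact: ifx.
have EFy y : (\int[mu]_x (f x y)%:E = (\int[mu]_x f x y)%:E)%E.
  by rewrite fineK//; apply: integrable_fin_num => //; exact: ify.
have iF : ((mu : {sigma_finite_measure set _ -> \bar R}) \x mu)%E.-integrable setT F.
  apply/integrable21ltyP => //.
  apply: (@le_lt_trans _ _ (\int[mu]_x `|(G x)%:E|)%E); last by case/integrableP: iG.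
  apply: ge0_le_integral => //.
  - by move=> x _; exact: integral_ge0.
  - apply: (measurable_fun_fubini_tonelli_G (abse \o F)) => //=.
    exact: measurableT_comp.
  - by apply: measurableT_comp => //; exact: measurable_int iG.
  - move=> x _; rewrite /= (le_trans _ (_ : (G x)%:E <= _)%E) ?lee_fin ?ler_norm//.
    have := fG x; rewrite -lee_fin; apply: le_trans.
    rewrite /Rintegral fineK//; apply: integrable_fin_num => //.
    exact: integrable_norm (ifx x).
split.
  have := integrable_fubini_F iF; apply: eq_integrable => // y _.
  by rewrite /fubini_F /= EFy.
have EX : (fun x => \int[mu]_y (f x y)%:E)%E = (fun x => (\int[mu]_y f x y)%:E).
  exact/funext.
have EY : (fun y => \int[mu]_x (f x y)%:E)%E = (fun y => (\int[mu]_x f x y)%:E).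
  exact/funext.
transitivity (fine (\int[mu]_x \int[mu]_y (f x y)%:E)%E); first by rewrite EX.
transitivity (fine (\int[mu]_y \int[mu]_x (f x y)%:E)%E); last by rewrite EY.
congr fine; symmetry; exact: Fubini iF.
Qed.

Lemma Rintegral_split0 f : mu.-integrable setT (EFin \o f) ->
  \int[mu]_x f x = \int[mu]_(x in `]-oo, 0]) f x + \int[mu]_(x in `[0, +oo[) f x.
Proof.
move=> intf.
have mf := integrable_measurable intf.
have -> : [set: R] = `]-oo, 0] `|` `]0, +oo[.
  by apply/seteqP; split=> x //= _; rewrite !in_itv/= andbT; apply/orP; case: leP.
rewrite Rintegral_setU//=.
- by rewrite Rintegral_itv_obnd_cbnd//; apply: integrableS intf.
- by apply: integrableS intf => //; exact: measurableU.
- rewrite disj_set2E; apply/eqP; rewrite -subset0 => x [] /=.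
  by rewrite !in_itv/= andbT => x0 /lt_le_trans/(_ x0); rewrite ltxx.
Qed.

Lemma integrable_oneDsqrV : mu.-integrable setT (EFin \o (fun x : R => (1 + x ^+ 2)^-1)).
Proof.
have -> : (fun x : R => (1 + x ^+ 2)^-1) = (fun x => (oneDsqr x)^-1) by [].
apply/integrableP; split.
  by apply/measurable_EFinP; exact: continuous_measurable_fun continuous_oneDsqrV.
under eq_integral do rewrite /= ger0_norm ?invr_ge0//.
rewrite (@ge0_symfun_integralT R (fun x => (oneDsqr x)^-1))//.
- by rewrite -set_itvcy integral0y_oneDsqr -EFinM ltry.
- exact: continuous_oneDsqrV.
- by move=> x; rewrite /= /oneDsqr sqrrN.
Qed.

End real_integrals.

(** * Sine and cosine transforms of smooth decaying functions *)

Section fourier.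
Context (R : realType).
Local Notation mu := (@lebesgue_measure R).
Implicit Types f h k F : R -> R.

(** The successive derivatives of a smooth function, g n being the n-th one. *)
Definition decay_chain (g : nat -> R -> R) :=
  forall n, expdecay (g n) /\ forall x : R, is_derive x 1 (g n) (g n.+1 x).

(** The functions transformed below are real-valued, so the real and imaginary
    parts of the transform can be handled as two separate real integrals. *)
Definition fcos h (t : R) := \int[mu]_s (h s * cos (t * s)).
Definition fsin h (t : R) := \int[mu]_s (h s * sin (t * s)).

Lemma continuous_cosM (t : R) : continuous (fun s : R => cos (t * s)).
Proof.
move=> s; apply: continuous_comp; last exact: continuous_cos.
by apply: cvgM; [exact: cvg_cst|exact: cvg_id].
Qed.

Lemma continuous_sinM (t : R) : continuous (fun s : R => sin (t * s)).
Proof.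
move=> s; apply: continuous_comp; last exact: continuous_sin.
by apply: cvgM; [exact: cvg_cst|exact: cvg_id].
Qed.

Lemma is_derive_continuous f (df : R -> R) :
  (forall x : R, is_derive x 1 f (df x)) -> continuous f.
Proof.
by move=> h x; apply/differentiable_continuous/derivable1_diffP; exact: ex_derive.
Qed.

Lemma integrable_mul_cos h (t : R) : mu.-integrable setT (EFin \o h) ->
  mu.-integrable setT (EFin \o (fun s => h s * cos (t * s))).
Proof.
move=> ih; apply: (integrable_mul_bounded (M := 1)) => //.
- by apply: continuous_measurable_fun; exact: continuous_cosM.
- by move=> x; exact: cos_max.
Qed.

Lemma integrable_mul_sin h (t : R) : mu.-integrable setT (EFin \o h) ->
  mu.-integrable setT (EFin \o (fun s => h s * sin (t * s))).
Proof.
move=> ih; apply: (integrable_mul_bounded (M := 1)) => //.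
- by apply: continuous_measurable_fun; exact: continuous_sinM.
- by move=> x; exact: sin_max.
Qed.

Lemma fcosN h t : fcos h (- t) = fcos h t.
Proof. by rewrite /fcos; apply: eq_Rintegral => s _; rewrite mulNr cosN. Qed.

Lemma fsinN h t : mu.-integrable setT (EFin \o h) -> fsin h (- t) = - fsin h t.
Proof.
move=> ih; rewrite /fsin -[RHS]mulN1r -RintegralZl//; last exact: integrable_mul_sin.
by apply: eq_Rintegral => s _; rewrite mulNr sinN mulrN mulN1r.
Qed.

Lemma fcos_shift h c t : mu.-integrable setT (EFin \o h) ->
  fcos (fun s => h (s + c)) t = cos (t * c) * fcos h t + sin (t * c) * fsin h t.
Proof.
move=> ih; have ic := integrable_mul_cos t ih; have js := integrable_mul_sin t ih.
have icc := integrableZl measurableT (cos (t * c)) ic.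
have iss := integrableZl measurableT (sin (t * c)) js.
rewrite /fcos /fsin -!RintegralZl// -RintegralD//.
have [_ <-] := integral_shift c (integrableD measurableT icc iss).
apply: eq_Rintegral => s _; have -> : t * s = t * (s + c) - t * c by ring.
by rewrite cosB; ring.
Qed.

Lemma fsin_shift h c t : mu.-integrable setT (EFin \o h) ->
  fsin (fun s => h (s + c)) t = cos (t * c) * fsin h t - sin (t * c) * fcos h t.
Proof.
move=> ih; have ic := integrable_mul_cos t ih; have js := integrable_mul_sin t ih.
have ics := integrableZl measurableT (cos (t * c)) js.
have isc := integrableZl measurableT (sin (t * c)) ic.
rewrite /fcos /fsin -!RintegralZl// -RintegralB//.
have [_ <-] := integral_shift c (integrableB measurableT ics isc).
apply: eq_Rintegral => s _; have -> : t * s = t * (s + c) - t * c by ring.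
by rewrite sinB; ring.
Qed.

Lemma bounded_cvg0 (T : Type) (F : set_system T) {FF : ProperFilter F} (u v : T -> R) (M : R) :
  u x @[x --> F] --> (0 : R) -> (forall x, `|v x| <= M) ->
  u x * v x @[x --> F] --> (0 : R).
Proof.
move=> u0 vM; apply: norm_cvg0.
have h : M * `|u x| @[x --> F] --> (0 : R).
  rewrite -[X in _ --> X](mulr0 M); apply: cvgM; first exact: cvg_cst.
  by rewrite -(normr0 R); exact: cvg_norm.
apply: (squeeze_cvgr _ (cvg_cst 0) h); apply: nearW => x.
by rewrite normr_ge0/= normrM mulrC ler_wpM2r.
Qed.

Section chain.
Variables (g : nat -> R -> R) (cg : decay_chain g).

Lemma chain_derive n (x : R) : is_derive x 1 (g n) (g n.+1 x).
Proof. exact: (cg n).2. Qed.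

Lemma chain_continuous n : continuous (g n).
Proof. exact: is_derive_continuous (@chain_derive n). Qed.

Lemma chain_integrable n : mu.-integrable setT (EFin \o g n).
Proof.
apply: expdecay_integrable; last exact: (cg n).1.
exact: continuous_measurable_fun (@chain_continuous n).
Qed.

(** There is no boundary term: g n vanishes at infinity and k is bounded. *)
Lemma integral_by_parts n k (dk : R -> R) (M M' : R) :
  (forall x : R, is_derive x 1 k (dk x)) -> continuous dk ->
  (forall x, `|k x| <= M) -> (forall x, `|dk x| <= M') ->
  \int[mu]_x (g n.+1 x * k x) = - \int[mu]_x (g n x * dk x).
Proof.
move=> hk cdk kM dkM'.
have ck := is_derive_continuous hk.
have i1 : mu.-integrable setT (EFin \o (fun x => g n.+1 x * k x)).
  apply: integrable_mul_bounded kM; first exact: chain_integrable.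
  exact: continuous_measurable_fun.
have i2 : mu.-integrable setT (EFin \o (fun x => g n x * dk x)).
  apply: integrable_mul_bounded dkM'; first exact: chain_integrable.
  exact: continuous_measurable_fun.
have hg := chain_derive n.
have d x : is_derive (x : R) 1 (fun x => g n x * k x) (g n.+1 x * k x + g n x * dk x).
  by apply: is_derive_eq; rewrite /GRing.scale/= addrC mulrC.
have c x : {for x, continuous (fun x => g n.+1 x * k x + g n x * dk x)}.
  apply: cvgD; apply: cvgM; try exact: chain_continuous; [exact: ck|exact: cdk].
have := integral_FTC2T c d (integrableD _ i1 i2) (l := 0) (l' := 0).
rewrite RintegralD// subr0 => /(_ _ _ _)/eqP; rewrite addr_eq0 => h.
apply/eqP/h => //.
- exact: bounded_cvg0 (expdecay_cvgNy (cg n).1) kM.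
- exact: bounded_cvg0 (expdecay_cvgy (cg n).1) kM.
Qed.

Lemma fcos_chain n t : fcos (g n.+1) t = t * fsin (g n) t.
Proof.
have d (x : R) : is_derive x 1 (fun s => cos (t * s)) (- t * sin (t * x)).
  by apply: is_derive_eq; rewrite /GRing.scale/=; ring.
rewrite /fcos (integral_by_parts n (M := 1) (M' := `|t|) d).
- under eq_Rintegral do rewrite mulrCA.
  rewrite RintegralZl ?mulNr ?opprK//.
  exact/integrable_mul_sin/chain_integrable.
- by move=> x; apply: cvgM; [exact: cvg_cst|exact: continuous_sinM].
- by move=> x; exact: cos_max.
- by move=> x; rewrite normrM normrN ler_piMr// sin_max.
Qed.

Lemma fsin_chain n t : fsin (g n.+1) t = - t * fcos (g n) t.
Proof.
have d (x : R) : is_derive x 1 (fun s => sin (t * s)) (t * cos (t * x)).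
  by apply: is_derive_eq; rewrite /GRing.scale/=; ring.
rewrite /fsin (integral_by_parts n (M := 1) (M' := `|t|) d).
- under eq_Rintegral do rewrite mulrCA.
  rewrite RintegralZl ?mulNr//.
  exact/integrable_mul_cos/chain_integrable.
- by move=> x; apply: cvgM; [exact: cvg_cst|exact: continuous_cosM].
- by move=> x; exact: sin_max.
- by move=> x; rewrite normrM ler_piMr// cos_max.
Qed.

End chain.
End fourier.

(** * Fourier inversion at the origin *)

Section inversion.
Context (R : realType).
Local Notation mu := (@lebesgue_measure R).
Implicit Types f h k F : R -> R.

Lemma poisson_bound (e s a b : R) : 0 < e -> `|a| <= 1 -> `|b| <= 1 ->
  `|(e * a + s * b) / (e ^+ 2 + s ^+ 2)| <= (e + `|s|) / (e ^+ 2 + s ^+ 2).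
Proof.
move=> e0 a1 b1; have d0 : 0 < e ^+ 2 + s ^+ 2 by rewrite ltr_wpDr ?sqr_ge0// exprn_gt0.
rewrite normrM normfV (gtr0_norm d0) ler_pM2r ?invr_gt0//.
rewrite (le_trans (ler_normD _ _))// lerD// normrM ?(gtr0_norm e0) ler_piMr//.
exact: ltW.
Qed.

Lemma cvgNy_expR (e : R) : 0 < e -> expR (e * t) @[t --> -oo] --> (0 : R).
Proof.
move=> e0; apply/cvgNy_compNP => /=.
by under eq_fun do rewrite /= mulrN; exact: cvgy_expRN.
Qed.

(** With c = e on the left half-line and c = - e on the right one, the integrand
    has the antiderivative
    e^(ct) (c cos(st) + s sin(st)) / (e^2 + s^2), which vanishes at infinity;
    each half-line contributes e / (e^2 + s^2). *)
Lemma poisson_kernel (e s : R) : 0 < e ->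
  \int[mu]_t (expR (- (e * `|t|)) * cos (s * t)) = 2 * e / (e ^+ 2 + s ^+ 2).
Proof.
move=> e0; have d0 : 0 < e ^+ 2 + s ^+ 2 by rewrite ltr_wpDr ?sqr_ge0// exprn_gt0.
have int := integrable_mul_cos s (integrable_expRNnorm e0).
have h (c : R) : continuous (fun t => expR (c * t) * cos (s * t)).
  move=> t; apply: cvgM; last exact: continuous_cosM.
  apply: continuous_comp; last exact: continuous_expR.
  by apply: cvgM; [exact: cvg_cst|exact: cvg_id].
have dF (c t : R) : c ^+ 2 = e ^+ 2 ->
    is_derive t 1 (fun t => expR (c * t) * ((c * cos (s * t) + s * sin (s * t)) / (e ^+ 2 + s ^+ 2)))
      (expR (c * t) * cos (s * t)).
  move=> ce; apply: is_derive_eq; rewrite /GRing.scale/= -ce.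
  by field; rewrite ce lt0r_neq0.
rewrite Rintegral_split0//.
rewrite (_ : \int[mu]_(t in `]-oo, 0]) _ = e / (e ^+ 2 + s ^+ 2)); last first.
  transitivity (\int[mu]_(t in `]-oo, 0]) (expR (e * t) * cos (s * t))).
    apply: eq_Rintegral => t; rewrite inE/= in_itv/= => t0; rewrite ler0_norm//.
    by congr (expR _ * _); ring.
  rewrite (@integral_FTC2Ny R _ _ 0 0 (h e) (fun t => dF e t (erefl _)))//.
  - by rewrite !mulr0 expR0 cos0 sin0 !(mul1r,mulr1,mulr0,addr0,subr0).
  - have : mu.-integrable `]-oo, 0] (EFin \o (fun t => expR (- (e * `|t|)) * cos (s * t))).
      by apply: integrableS int.
    apply: eq_integrable => // t; rewrite inE/= in_itv/= => t0; rewrite ler0_norm//.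
    by congr (expR _ * _)%:E; ring.
  - apply: (bounded_cvg0 (M := (e + `|s|) / (e ^+ 2 + s ^+ 2))).
      exact: cvgNy_expR.
    by move=> t; rewrite poisson_bound ?cos_max ?sin_max.
rewrite (_ : \int[mu]_(t in `[0, +oo[) _ = e / (e ^+ 2 + s ^+ 2)); last first.
  transitivity (\int[mu]_(t in `[0, +oo[) (expR (- e * t) * cos (s * t))).
    apply: eq_Rintegral => t; rewrite inE/= in_itv/= andbT => t0; rewrite ger0_norm//.
    by congr (expR _ * _); ring.
  rewrite (@integral_FTC2y R _ _ 0 0 (h (- e)) (fun t => dF (- e) t (sqrrN _)))//.
  - by rewrite !mulr0 expR0 cos0 sin0 !(mul1r,mulr1,mulr0,addr0,sub0r) mulNr opprK.
  - have : mu.-integrable `[0, +oo[ (EFin \o (fun t => expR (- (e * `|t|)) * cos (s * t))).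
      by apply: integrableS int.
    apply: eq_integrable => // t; rewrite inE/= in_itv/= andbT => t0; rewrite ger0_norm//.
    by congr (expR _ * _)%:E; ring.
  - apply: (bounded_cvg0 (M := (e + `|s|) / (e ^+ 2 + s ^+ 2))).
      by under eq_fun do rewrite mulNr; exact: cvgy_expRN.
    by move=> t; rewrite mulNr -mulrN poisson_bound ?normrN ?cos_max ?sin_max.
by field; rewrite lt0r_neq0.
Qed.

(** The damping makes the double integral absolutely convergent.  The integrability
    of the damped transform is recorded because the measurability of the
    transform is deduced from it. *)
Lemma Fubini_damped h k (e : R) : 0 < e -> mu.-integrable setT (EFin \o h) ->
  measurable_fun setT k -> (forall x, `|k x| <= 1) ->
  mu.-integrable setT
    (EFin \o (fun t => expR (- (e * `|t|)) * \int[mu]_s (h s * k (t * s)))) /\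
  \int[mu]_t (expR (- (e * `|t|)) * \int[mu]_s (h s * k (t * s))) =
  \int[mu]_s (h s * \int[mu]_t (expR (- (e * `|t|)) * k (s * t))).
Proof.
move=> e0 ih mk k1.
have mkM (c : R) : measurable_fun setT (fun x => k (c * x)).
  by apply: measurableT_comp => //; apply: measurable_funM.
have iE := integrable_expRNnorm e0.
have iEk s := integrable_mul_bounded iE (mkM s) (fun x => k1 (s * x)).
have ihk t := integrable_mul_bounded ih (mkM t) (fun x => k1 (t * x)).
pose f s t := h s * (expR (- (e * `|t|)) * k (s * t)).
have EX s : \int[mu]_t f s t = h s * \int[mu]_t (expR (- (e * `|t|)) * k (s * t)).
  by rewrite /f RintegralZl//.
have EY t : \int[mu]_s f s t = expR (- (e * `|t|)) * \int[mu]_s (h s * k (t * s)).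
  by rewrite -RintegralZl//; apply: eq_Rintegral => s _; rewrite /f mulrCA (mulrC t).
have [|||||] := @Rintegral_Fubini R f (fun s => `|h s| * \int[mu]_t (expR (- (e * `|t|)))).
- rewrite /f; apply: measurable_funM.
    exact: (measurableT_comp (integrable_measurable ih) measurable_fst).
  apply: measurable_funM.
    exact: (measurableT_comp (integrable_measurable iE) measurable_snd).
  exact: (measurableT_comp mk (measurable_funM measurable_fst measurable_snd)).
- by move=> s; exact: (integrableZl _ (h s) (iEk s)).
- move=> t; have := integrableZl measurableT (expR (- (e * `|t|))) (ihk t).
  by apply: eq_integrable => // s _; rewrite /f/= -EFinM mulrCA (mulrC t).
- move=> s; rewrite -RintegralZl//; apply: le_Rintegral => //.
  + exact: (integrable_norm (integrableZl _ (h s) (iEk s))).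
  + exact: (integrableZl _ `|h s| iE).
  + by move=> t _; rewrite /f !normrM ler_wpM2l// ger0_norm ?expR_ge0// ler_piMr ?expR_ge0.
- exact: (integrableZr measurableT _ (integrable_norm ih)).
move=> i eqi; split.
  by move: i; apply: eq_integrable => // t _; rewrite /= EY.
under eq_Rintegral do rewrite -EY.
by rewrite -eqi; apply: eq_Rintegral => s _; rewrite EX.
Qed.

(** Abel summation of an integrable function returns its integral. *)
Lemma Rintegral_damped_cvg f : mu.-integrable setT (EFin \o f) ->
  \int[mu]_t (expR (- (n.+1%:R^-1 * `|t|)) * f t) @[n --> \oo] --> \int[mu]_t f t.
Proof.
move=> intf; have mf := integrable_measurable intf.
apply: (@cvg_Rintegral_dominated _ _ _ mu setT
  (fun n t => expR (- (n.+1%:R^-1 * `|t|)) * f t) f (fun t => `|f t|)) => //.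
- move=> n; apply: measurable_funM => //.
  have n0 : 0 < n.+1%:R^-1 :> R by rewrite invr_gt0.
  exact: integrable_measurable (integrable_expRNnorm n0).
- move=> t _; rewrite -[X in _ --> X]mul1r; apply: cvgM; last exact: cvg_cst.
  rewrite -[X in _ --> X](@expR0 R); apply: continuous_cvg; first exact: continuous_expR.
  rewrite -[X in _ --> X]oppr0; apply: cvgN; rewrite -[X in _ --> X](mul0r `|t|).
  by apply: cvgM; [exact: (@cvg_harmonic R)|exact: cvg_cst].
- exact: integrable_norm.
- by move=> n t _; rewrite normrM ger0_norm ?expR_ge0// ler_piMl.
Qed.

Lemma norm_atan_le (x : R) : `|atan x| <= pi / 2.
Proof. by rewrite ler_norml ltW ?atan_gtNpi2// ltW ?atan_ltpi2. Qed.

Lemma continuous_atanM (c : R) : continuous (fun s : R => 2 * atan (s / c)).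
Proof.
move=> s; apply: cvgM; first exact: cvg_cst.
apply: continuous_comp; last exact: continuous_atan.
by apply: cvgM; [exact: cvg_id|exact: cvg_cst].
Qed.

Lemma cvg_atan_sg (x : R) : 2 * atan (x / n.+1%:R^-1) @[n --> \oo] --> pi * Num.sg x.
Proof.
have pos (y : R) : 0 < y -> 2 * atan (y / n.+1%:R^-1) @[n --> \oo] --> pi.
  move=> y0; rewrite (_ : pi = 2 * (pi / 2)); last by field.
  apply: cvgM; first exact: cvg_cst.
  under eq_fun do rewrite invrK.
  apply: cvg_comp (cvgy_atan (R := R)).
  exact: cvg_comp (@cvgn_natSr R) (gt0_cvgMry y0 cvg_id).
have [x0|x0|->] := ltgtP x 0.
- rewrite ltr0_sg// mulrN1.
  have Nx0 : 0 < - x by rewrite oppr_gt0.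
  rewrite (_ : (fun n => _) = (fun n => - (2 * atan (- x / n.+1%:R^-1)))).
    exact: cvgN (pos _ Nx0).
  by apply/funext => n; rewrite mulNr atanN mulrN opprK.
- by rewrite gtr0_sg// mulr1; exact: pos.
- rewrite sgr0 mulr0; under eq_fun do rewrite mul0r atan0 mulr0.
  exact: cvg_cst.
Qed.

Section chain.
Variables (g : nat -> R -> R) (cg : decay_chain g).

(** Each half-line contributes - pi g(0): the integral of g' is g(0) on the left
    and - g(0) on the right, and the sign function reverses the former. *)
Lemma integral_chain_sg :
  \int[mu]_s (g 1 s * (pi * Num.sg s)) = - (2 * pi * g 0 0).
Proof.
have ig := chain_integrable cg 1.
have mat n : measurable_fun setT (fun s : R => 2 * atan (s / n.+1%:R^-1)).
  exact: continuous_measurable_fun (@continuous_atanM _).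
have msg : measurable_fun setT (fun s : R => pi * Num.sg s).
  exact: measurable_pointwise_limit measurableT mat (fun s _ => @cvg_atan_sg s).
have i : mu.-integrable setT (EFin \o (fun s => g 1 s * (pi * Num.sg s))).
  apply: (integrable_mul_bounded (M := pi)) => // s.
  rewrite normrM ger0_norm ?pi_ge0// ler_piMr ?pi_ge0// normr_sg.
  by case: (s != 0).
have dg := chain_derive cg 0; have c1 := chain_continuous cg (n := 1).
have igS (D : set R) : measurable D -> mu.-integrable D (EFin \o g 1).
  by move=> mD; apply: integrableS ig.
have iS (D : set R) : measurable D ->
    mu.-integrable D (EFin \o (fun s => g 1 s * (pi * Num.sg s))).
  by move=> mD; apply: integrableS i.
rewrite Rintegral_split0//.
(* The endpoint 0, where the sign function vanishes, is removed and put back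
   once that function has become constant. *)
rewrite -Rintegral_itv_bndo_bndc; last exact: iS.
rewrite -Rintegral_itv_obnd_cbnd; last exact: iS.
rewrite (_ : \int[mu]_(s in `]-oo, 0[) _ = - pi * \int[mu]_(s in `]-oo, 0[) g 1 s); last first.
  rewrite -RintegralZl//; last exact: igS.
  apply: eq_Rintegral => s; rewrite inE/= in_itv/= => s0.
  by rewrite ltr0_sg// mulrN1 mulrC.
rewrite (_ : \int[mu]_(s in `]0, +oo[) _ = pi * \int[mu]_(s in `]0, +oo[) g 1 s); last first.
  rewrite -RintegralZl//; last exact: igS.
  apply: eq_Rintegral => s; rewrite inE/= in_itv/= andbT => s0.
  by rewrite gtr0_sg// mulr1 mulrC.
rewrite Rintegral_itv_bndo_bndc; last exact: igS.
rewrite Rintegral_itv_obnd_cbnd; last exact: igS.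
rewrite (integral_FTC2y c1 dg _ (expdecay_cvgy (cg 0).1)); last exact: igS.
rewrite (integral_FTC2Ny c1 dg _ (expdecay_cvgNy (cg 0).1)); last exact: igS.
ring.
Qed.

(** The transform is its damped version, measurable by Fubini, divided by the
    damping factor. *)
Lemma measurable_transform h k : mu.-integrable setT (EFin \o h) ->
  measurable_fun setT k -> (forall x, `|k x| <= 1) ->
  measurable_fun setT (fun t : R => \int[mu]_s (h s * k (t * s))).
Proof.
move=> ih mk k1.
have [/integrable_measurable md _] := Fubini_damped ltr01 ih mk k1.
rewrite (_ : (fun t => _) = (fun t => expR `|t| * (expR (- (1 * `|t|)) * \int[mu]_s (h s * k (t * s))))).
  by apply: measurable_funM => //; apply: measurableT_comp.
by apply/funext => t; rewrite mul1r mulrA expRxMexpNx_1 mul1r.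
Qed.

Lemma chain_transform_bound k : measurable_fun setT k -> (forall x, `|k x| <= 1) ->
  forall t n, `|\int[mu]_s (g n s * k (t * s))| <= \int[mu]_s `|g n s|.
Proof.
move=> mk k1 t n; have ig := chain_integrable cg n.
have mkM (c : R) : measurable_fun setT (fun x => k (c * x)).
  by apply: measurableT_comp => //; apply: measurable_funM.
have i := integrable_mul_bounded ig (mkM t) (fun x => k1 (t * x)).
apply: (le_trans (le_normr_Rintegral _ i)) => //.
apply: le_Rintegral => //; [exact: integrable_norm i|exact: integrable_norm ig|].
by move=> s _; rewrite normrM ler_piMr.
Qed.

Lemma integrable_quadratic_decay f (A B : R) : measurable_fun setT f ->
  (forall t, `|f t| <= A) -> (forall t, t ^+ 2 * `|f t| <= B) ->
  mu.-integrable setT (EFin \o f).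
Proof.
move=> mf fA fB.
apply: (@integrable_le _ _ _ mu setT f (fun t => (A + B) * (1 + t ^+ 2)^-1)) => //.
  move=> t _; rewrite ler_pdivlMr ?ltr_wpDr ?sqr_ge0//.
  by rewrite mulrDr mulr1 mulrC lerD// mulrC.
exact: (integrableZl _ (A + B) (@integrable_oneDsqrV R)).
Qed.

(** Transforming g'' multiplies the transform of g by - t^2, so t^2 times the
    latter is bounded by the integral of |g''|. *)
Lemma integrable_fcos : mu.-integrable setT (EFin \o fcos (g 0)).
Proof.
have mc := continuous_measurable_fun (@continuous_cos R).
have b := chain_transform_bound mc (@cos_max R).
apply: integrable_quadratic_decay (b^~ 0) _ => //.
  exact: measurable_transform (chain_integrable cg 0) mc (@cos_max R).
move=> t; have := b t 2; rewrite -/(fcos (g 2) t).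
rewrite (fcos_chain cg) (fsin_chain cg) mulrA mulrN normrM normrN -expr2.
by rewrite (ger0_norm (sqr_ge0 t)); exact: id.
Qed.

Lemma integrable_fsin : mu.-integrable setT (EFin \o fsin (g 0)).
Proof.
have mc := continuous_measurable_fun (@continuous_sin R).
have b := chain_transform_bound mc (@sin_max R).
apply: integrable_quadratic_decay (b^~ 0) _ => //.
  exact: measurable_transform (chain_integrable cg 0) mc (@sin_max R).
move=> t; have := b t 2; rewrite -/(fsin (g 2) t).
rewrite (fsin_chain cg) (fcos_chain cg) mulrA mulNr normrM normrN -expr2.
by rewrite (ger0_norm (sqr_ge0 t)); exact: id.
Qed.

Lemma integral_fsin : \int[mu]_t fsin (g 0) t = 0.
Proof.
apply: integral_odd; first exact: integrable_fsin.
by move=> t; apply: fsinN; exact: chain_integrable.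
Qed.

(** Integrating the Poisson kernel by parts trades an approximate identity for the
    bounded functions 2 atan(s / e), to which dominated convergence applies as e
    tends to 0. *)
Lemma poisson_abel (e : R) : 0 < e ->
  \int[mu]_t (expR (- (e * `|t|)) * fcos (g 0) t) =
  - \int[mu]_s (g 1 s * (2 * atan (s / e))).
Proof.
move=> e0.
have mc := continuous_measurable_fun (@continuous_cos R).
have [_ ->] := Fubini_damped e0 (chain_integrable cg 0) mc (@cos_max R).
have d0 (s : R) : 0 < e ^+ 2 + s ^+ 2 by rewrite ltr_wpDr ?sqr_ge0// exprn_gt0.
have e00 := lt0r_neq0 e0.
have dk (s : R) : is_derive s 1 (fun s => 2 * atan (s / e)) (2 * e / (e ^+ 2 + s ^+ 2)).
  apply: is_derive_eq; rewrite /GRing.scale/=.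
  by field; rewrite e00 lt0r_neq0//= addrC.
rewrite (integral_by_parts cg 0 (M := pi) (M' := 2 / e) dk).
- rewrite opprK; apply: eq_Rintegral => s _; by rewrite poisson_kernel.
- move=> s; apply: cvgM; first exact: cvg_cst.
  apply: cvgV; first exact: lt0r_neq0.
  by apply: cvgD; [exact: cvg_cst|exact: exprn_continuous].
- move=> s; rewrite normrM (ger0_norm (ler0n _ _)).
  by have := norm_atan_le (s / e); lra.
- move=> s; rewrite ger0_norm; last by rewrite divr_ge0 ?ltW// mulr_gt0.
  rewrite -mulrA ler_pM2l// ler_pdivrMr// mulrC ler_pdivlMr// -expr2.
  by rewrite lerDl sqr_ge0.
Qed.

(** Fourier inversion at the origin: the damped integrals tend to both sides. *)
Lemma integral_fcos : \int[mu]_t fcos (g 0) t = 2 * pi * g 0 0.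
Proof.
have h1 := Rintegral_damped_cvg integrable_fcos.
have h2 : \int[mu]_t (expR (- (n.+1%:R^-1 * `|t|)) * fcos (g 0) t) @[n --> \oo] -->
    - \int[mu]_s (g 1 s * (pi * Num.sg s)).
  under eq_fun do rewrite poisson_abel ?invr_gt0//.
  apply: cvgN.
  apply: (@cvg_Rintegral_dominated _ _ _ mu setT
    (fun n s => g 1 s * (2 * atan (s / n.+1%:R^-1))) _ (fun s => pi * `|g 1 s|)) => //.
  - move=> n; apply: measurable_funM.
      exact: integrable_measurable (chain_integrable cg 1).
    exact: continuous_measurable_fun (@continuous_atanM _).
  - by move=> s _; apply: cvgM; [exact: cvg_cst|exact: cvg_atan_sg].
  - exact: (integrableZl _ pi (integrable_norm (chain_integrable cg 1))).
  - move=> n s _; rewrite normrM mulrC ler_wpM2r// normrM (ger0_norm (ler0n _ _)).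
    by have := norm_atan_le (s / n.+1%:R^-1); lra.
transitivity (- \int[mu]_s (g 1 s * (pi * Num.sg s))).
  exact: cvg_unique h1 h2.
by rewrite integral_chain_sg opprK.
Qed.

End chain.
End inversion.

(** * The complex Fourier transform and its moments *)

Local Open Scope complex_scope.

Section complex_transform.
Context (R : realType).
Local Notation mu := (@lebesgue_measure R).
Implicit Types f h : R -> R.

(** The transform of h for the kernel e^(its). *)
Definition fourier h (t : R) : R[i] := fcos h t +i* fsin h t.

Lemma eq_has_integralC (D : set R) (f g : R -> R[i]) v :
  f =1 g -> has_integralC D g v -> has_integralC D f v.
Proof. by move=> /funext ->. Qed.

Lemma has_integralC_Zi (D : set R) (f : R -> R[i]) v : measurable D ->
  has_integralC D f v -> has_integralC D (fun t => 'i%C * f t) ('i%C * v).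
Proof.
move=> mD [[iRe iIm] <-].
have Re_i z : complex.Re ('i%C * z) = - 1 * complex.Im z by case: z => x y /=; ring.
have Im_i z : complex.Im ('i%C * z) = complex.Re z by case: z => x y /=; ring.
split; first split.
- under eq_fun do rewrite Re_i EFinM; exact: integrableZl.
- by under eq_fun do rewrite Im_i.
- apply/eqP; rewrite eq_complex /integralC Re_i Im_i/=.
  under eq_Rintegral do rewrite Re_i.
  rewrite RintegralZl// eqxx/=.
  by under eq_Rintegral do rewrite Im_i.
Qed.

Lemma has_integralC_ZiX (D : set R) (f : R -> R[i]) v n : measurable D ->
  has_integralC D f v -> has_integralC D (fun t => 'i%C ^+ n * f t) ('i%C ^+ n * v).
Proof.
move=> mD fv; elim: n => [|n /(has_integralC_Zi mD)].
  by rewrite expr0 mul1r; under eq_fun do rewrite mul1r.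
by rewrite exprS -mulrA; under [in X in _ -> X]eq_fun do rewrite -mulrA.
Qed.

Lemma fourier_shift h (l t : R) : mu.-integrable setT (EFin \o h) ->
  expC (- 'i%C * l%:C * t%:C) * fourier h t = fourier (fun s => h (s + l)) t.
Proof.
move=> ih; rewrite /fourier fcos_shift// fsin_shift//.
have -> : expC (- 'i%C * l%:C * t%:C) = cos (t * l) -i* sin (t * l).
  rewrite /expC.
  have -> : complex.Re (- 'i%C * l%:C * t%:C) = 0 by rewrite /=; ring.
  have -> : complex.Im (- 'i%C * l%:C * t%:C) = - (t * l) by rewrite /=; ring.
  by rewrite expR0 cosN sinN mul1r.
by apply/eqP; rewrite eq_complex /=; apply/andP; split; apply/eqP; ring.
Qed.

Lemma expdecay_shift f l : expdecay f -> expdecay (fun s => f (s + l)).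
Proof.
move=> [K [c [c0 fK]]]; exists (`|K| * expR (c * `|l|)), c; split=> // s.
rewrite -mulrA -expRD (le_trans (fK _))//.
rewrite (le_trans (ler_wpM2r (expR_ge0 _) (ler_norm K)))//.
rewrite ler_wpM2l// ler_expR -mulrBr -lerN2 opprK -mulrN opprB ler_pM2l//.
by rewrite lerBlDr -{1}(addrK l s) ler_normB.
Qed.

Section chain.
Variables (g : nat -> R -> R) (cg : decay_chain g).

Lemma decay_chain_shift l : decay_chain (fun n s => g n (s + l)).
Proof.
move=> n; split; first exact: expdecay_shift (cg n).1.
move=> x; have dg := chain_derive cg n.
by apply: is_derive_eq; rewrite addr0 mulr1.
Qed.

Lemma decay_chain_drop n : decay_chain (fun k => g (n + k)%N).
Proof. by move=> k; rewrite addnS; exact: cg. Qed.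

Lemma mul_fourier n t : t%:C * fourier (g n) t = 'i%C * fourier (g n.+1) t.
Proof.
rewrite /fourier (fcos_chain cg) (fsin_chain cg).
by apply/eqP; rewrite eq_complex /=; apply/andP; split; apply/eqP; ring.
Qed.

Lemma mulX_fourier n t : t%:C ^+ n * fourier (g 0) t = 'i%C ^+ n * fourier (g n) t.
Proof.
elim: n => [|n IH]; first by rewrite !expr0 !mul1r.
by rewrite exprS -mulrA IH mulrCA mul_fourier mulrA -exprSr.
Qed.

(** Inversion at the origin.  The imaginary part of the transform is odd, so it
    integrates to 0. *)
Lemma has_integralC_fourier : has_integralC setT (fourier (g 0)) (2 * pi * g 0 0)%:C.
Proof.
split; first by split; [exact: integrable_fcos|exact: integrable_fsin].
by rewrite /integralC/= integral_fcos// integral_fsin.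
Qed.

End chain.

(** The factor t^n differentiates n times and the exponential translates by l, so
    the integrand is i^n times the transform of s |-> g n (s + l), to which
    inversion at the origin applies. *)
Lemma fourier_moment (g : nat -> R -> R) (cg : decay_chain g) (n : nat) (l : R) :
  has_integralC setT
    (fun t => expC (- 'i%C * l%:C * t%:C) * t%:C ^+ n * fourier (g 0) t)
    ('i%C ^+ n * (2 * pi * g n l)%:C).
Proof.
apply: (@eq_has_integralC _ _ (fun t => 'i%C ^+ n * fourier (fun s => g n (s + l)) t)).
  move=> t; rewrite -mulrA (mulX_fourier cg) mulrCA fourier_shift//.
  exact: chain_integrable.
apply: has_integralC_ZiX => //.
have := has_integralC_fourier (decay_chain_drop (decay_chain_shift cg l) n).
by rewrite addn0 add0r.
Qed.

End complex_transform.

(** * The Gamma function as a Fourier transform *)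

Section gamma.
Context (R : realType).
Local Notation mu := (@lebesgue_measure R).
Implicit Types (a b c s t v x : R).

(** Euler's integrand x^c e^(-x) dx / x in the variable s = ln x. *)
Definition gamma_density c s : R := expR (c * s - expR s).

Definition gammaR c : R := \int[mu]_s gamma_density c s.

Lemma gamma_density_ge0 c s : 0 <= gamma_density c s.
Proof. exact: expR_ge0. Qed.

Lemma is_derive_gamma_density c x :
  is_derive x 1 (gamma_density c) (c * gamma_density c x - gamma_density (c + 1) x).
Proof.
rewrite /gamma_density; apply: is_derive_eq; rewrite /GRing.scale/=.
rewrite (_ : (c + 1) * x - expR x = c * x - expR x + x); last ring.
by rewrite (expRD (c * x - expR x)); ring.
Qed.

Lemma continuous_gamma_density c : continuous (gamma_density c).
Proof. exact: is_derive_continuous (is_derive_gamma_density c). Qed.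

(** On the left the factor e^(cs) decays.  On the right, the tangent line of exp at
    ln(2c) gives e^s >= 2c (1 + s - ln(2c)), that is
    cs - e^s <= 2c (ln(2c) - 1) - cs. *)
Lemma expdecay_gamma_density c : 0 < c -> expdecay (gamma_density c).
Proof.
move=> c0; pose d := c + c; have d0 : 0 < d by rewrite addr_gt0.
exists (1 + expR (d * (ln d - 1))), c; split=> // s.
rewrite ger0_norm ?gamma_density_ge0// /gamma_density mulrDl mul1r.
have [s0|s0] := leP 0 s.
  rewrite ger0_norm// (le_trans _ (_ : expR (d * (ln d - 1)) * expR (- (c * s)) <= _))//; last first.
    by rewrite lerDr expR_ge0.
  rewrite -expRD ler_expR.
  have h : d * (1 + (s - ln d)) <= expR s.
    rewrite -[leRHS](_ : d * expR (s - ln d) = _); last first.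
      by rewrite expRB lnK ?posrE// mulrC divfK// lt0r_neq0.
    by rewrite ler_pM2l// expR_ge1Dx.
  rewrite lerBlDr (le_trans _ (lerD (lexx _) h))//.
  by rewrite /d; lra.
rewrite ltr0_norm// (le_trans _ (_ : expR (- (c * - s)) <= _))//; last first.
  by rewrite lerDl mulr_ge0 ?expR_ge0.
by rewrite ler_expR mulrN opprK gerBl expR_ge0.
Qed.

Lemma integrable_gamma_density c : 0 < c ->
  mu.-integrable setT (EFin \o gamma_density c).
Proof.
move=> c0; apply: expdecay_integrable; last exact: expdecay_gamma_density.
exact: continuous_measurable_fun (@continuous_gamma_density c).
Qed.

(** The integral over the line of the derivative of the density is 0. *)
Lemma gammaRS c : 0 < c -> gammaR (c + 1) = c * gammaR c.
Proof.
move=> c0; have c10 : 0 < c + 1 by rewrite addr_gt0.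
have i1 := integrable_gamma_density c0.
have i2 := integrable_gamma_density c10.
have ic := integrableZl measurableT c i1.
have := integral_FTC2T _ (is_derive_gamma_density c) (integrableB measurableT ic i2)
  (expdecay_cvgNy (expdecay_gamma_density c0)) (expdecay_cvgy (expdecay_gamma_density c0)).
rewrite RintegralB// RintegralZl// subrr -/(gammaR c) -/(gammaR (c + 1)) => h.
apply/esym/eqP; rewrite -subr_eq0 h// => x; apply: cvgB.
  by apply: cvgM; [exact: cvg_cst|exact: continuous_gamma_density].
exact: continuous_gamma_density.
Qed.

Lemma gamma_subst a t (k : R -> R) : 0 < a -> continuous k ->
  (forall x, `|k x| <= 1) ->
  \int[mu]_(x in `]0, +oo[) (expR ((a - 1) * ln x) * k (t * ln x) * expR (- x)) =
  \int[mu]_s (gamma_density a s * k (t * s)).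
Proof.
move=> a0 ck k1.
pose G x := expR ((a - 1) * ln x) * k (t * ln x) * expR (- x).
have cG : {in `]0, +oo[%R, continuous G}.
  move=> x; rewrite in_itv/= andbT => x0.
  have cl (c : R) : {for x, continuous (fun x => c * ln x)}.
    by apply: cvgM; [exact: cvg_cst|exact: continuous_ln].
  apply: cvgM; last first.
    by apply: continuous_comp; [exact: continuousN|exact: continuous_expR].
  apply: cvgM.
    by apply: continuous_comp; [exact: cl|exact: continuous_expR].
  by apply: continuous_comp; [exact: cl|exact: ck].
have GE : (fun s => G (expR s) * expR s) = (fun s => gamma_density a s * k (t * s)).
  apply/funext => s; rewrite /G expRK /gamma_density.
  have -> : a * s - expR s = (a - 1) * s + - expR s + s by ring.
  by rewrite !expRD; ring.
have ik : mu.-integrable setT (EFin \o (fun s => G (expR s) * expR s)).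
  rewrite GE; apply: (integrable_mul_bounded (M := 1)) => //.
    exact: integrable_gamma_density.
  apply: continuous_measurable_fun => s; apply: continuous_comp; last exact: ck.
  by apply: cvgM; [exact: cvg_cst|exact: cvg_id].
by have [_] := integral_subst_expR cG ik; rewrite GE.
Qed.

Lemma GammaC_fourier a t : 0 < a ->
  GammaC (a%:C + 'i%C * t%:C) = fourier (gamma_density a) t.
Proof.
move=> a0; rewrite /GammaC /integralC /fourier /fcos /fsin.
rewrite -(gamma_subst t a0 (@continuous_cos R) (@cos_max R)).
rewrite -(gamma_subst t a0 (@continuous_sin R) (@sin_max R)).
have E x : expC ((a%:C + 'i%C * t%:C - 1) * (ln x)%:C) * (expR (- x))%:C =
    (expR ((a - 1) * ln x) * cos (t * ln x) * expR (- x)) +i*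
    (expR ((a - 1) * ln x) * sin (t * ln x) * expR (- x)).
  rewrite /expC.
  have -> : complex.Re ((a%:C + 'i%C * t%:C - 1) * (ln x)%:C) = (a - 1) * ln x.
    by rewrite /=; ring.
  have -> : complex.Im ((a%:C + 'i%C * t%:C - 1) * (ln x)%:C) = t * ln x.
    by rewrite /=; ring.
  by apply/eqP; rewrite eq_complex /=; apply/andP; split; apply/eqP; ring.
by congr (_ +i* _); apply: eq_Rintegral => x _; rewrite E.
Qed.

Lemma GammaC_gammaR c : 0 < c -> GammaC c%:C = (gammaR c)%:C.
Proof.
move=> c0; have := GammaC_fourier 0 c0.
rewrite mulr0 addr0 => ->; rewrite /fourier /fcos /fsin.
under eq_Rintegral do rewrite mul0r cos0 mulr1.
under [X in _ +i* X]eq_Rintegral do rewrite mul0r sin0 mulr0.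
by rewrite [X in _ +i* X]Rintegral_cst ?mul0r.
Qed.

(** Gamma(a + b) e^(as) / (1 + e^s)^(a + b), the integrand of the Beta function in
    logistic coordinates multiplied by Gamma(a + b). *)
Definition beta_density a b s : R :=
  gammaR (a + b) * expR (a * s - (a + b) * ln (1 + expR s)).

Lemma oneDexpR_gt0 s : 0 < 1 + expR s.
Proof. by rewrite addr_gt0 ?expR_gt0. Qed.

(** Since e^v + e^(s + v) = e^(v + ln(1 + e^s)), translating v by ln(1 + e^s) turns
    the product of the two densities into a multiple of the density of
    parameter a + b. *)
Lemma beta_densityE a b s : 0 < a -> 0 < b ->
  \int[mu]_v (gamma_density b v * gamma_density a (s + v)) = beta_density a b s.
Proof.
move=> a0 b0; have iab := integrable_gamma_density (addr_gt0 a0 b0).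
rewrite /beta_density mulrC /gammaR.
have [ish <-] := integral_shift (ln (1 + expR s)) iab.
rewrite -(RintegralZl _ measurableT ish); apply: eq_Rintegral => v _.
rewrite /gamma_density -!expRD; congr expR.
rewrite [in RHS]expRD lnK ?posrE ?oneDexpR_gt0// expRD.
ring.
Qed.

(** Fubini; the correlation of the two densities is then given by
    [beta_densityE]. *)
Lemma gamma_density_conv a b t (k : R -> R) : 0 < a -> 0 < b ->
  measurable_fun setT k -> (forall x, `|k x| <= 1) ->
  \int[mu]_v (gamma_density b v * \int[mu]_s (gamma_density a (s + v) * k (t * s))) =
  \int[mu]_s (beta_density a b s * k (t * s)).
Proof.
move=> a0 b0 mk k1.
have ia := integrable_gamma_density a0; have ib := integrable_gamma_density b0.
have mkt : measurable_fun setT (fun s => k (t * s)).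
  by apply: measurableT_comp => //; apply: measurable_funM.
have [K [c [c0 aK]]] := expdecay_gamma_density a0.
have aKb s : `|gamma_density a s| <= `|K|.
  rewrite (le_trans (aK _))// (le_trans (ler_wpM2r (expR_ge0 _) (ler_norm K)))//.
  by rewrite ler_piMr// expR_le1 oppr_le0 mulr_ge0// ltW.
have ma : measurable_fun setT (gamma_density a).
  exact: continuous_measurable_fun (@continuous_gamma_density a).
have mb : measurable_fun setT (gamma_density b).
  exact: continuous_measurable_fun (@continuous_gamma_density b).
have iav v : mu.-integrable setT (EFin \o (fun s => gamma_density a (s + v) * k (t * s))).
  apply: (integrable_mul_bounded (M := 1)) => //.
  exact: (integral_shift v ia).1.
have ibs s : mu.-integrable setT (EFin \o (fun v => gamma_density b v * gamma_density a (s + v))).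
  apply: (integrable_mul_bounded (M := `|K|)) => //.
  by apply: measurableT_comp => //; apply: measurable_funD.
pose f v s := gamma_density b v * (gamma_density a (s + v) * k (t * s)).
have EX v : \int[mu]_s f v s =
    gamma_density b v * \int[mu]_s (gamma_density a (s + v) * k (t * s)).
  by rewrite /f RintegralZl.
have EY s : \int[mu]_v f v s = beta_density a b s * k (t * s).
  rewrite -beta_densityE// -RintegralZr//.
  by apply: eq_Rintegral => v _; rewrite /f mulrA.
have [|||||_] := @Rintegral_Fubini R f (fun v => gamma_density b v * gammaR a).
- apply: measurable_funM; first exact: (measurableT_comp mb measurable_fst).
  apply: measurable_funM.
    exact: (measurableT_comp ma (measurable_funD measurable_snd measurable_fst)).
  exact: (measurableT_comp mkt measurable_snd).
- by move=> v; exact: (integrableZl _ (gamma_density b v) (iav v)).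
- move=> s; have := integrableZr measurableT (k (t * s)) (ibs s).
  by apply: eq_integrable => // v _; rewrite /f/= -EFinM mulrA.
- move=> v; rewrite /gammaR; have [iv <-] := integral_shift v ia.
  rewrite -(RintegralZl _ measurableT iv); apply: le_Rintegral => //.
  + exact: (integrable_norm (integrableZl _ (gamma_density b v) (iav v))).
  + exact: (integrableZl _ (gamma_density b v) iv).
  + move=> s _; rewrite /f !normrM !(ger0_norm (gamma_density_ge0 _ _)).
    apply: ler_wpM2l; first exact: gamma_density_ge0.
    by apply: ler_piMr => //; exact: gamma_density_ge0.
- exact: (integrableZr measurableT (gammaR a) ib).
move=> eqF.
under eq_Rintegral do rewrite -EX.
by rewrite eqF; apply: eq_Rintegral => s _; rewrite EY.
Qed.

(** The transform at - t of the second density is a complex conjugate, so the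
    product is the transform of a correlation and not of a convolution. *)
Lemma GammaC_mul_fourier a b t : 0 < a -> 0 < b ->
  GammaC (a%:C + 'i%C * t%:C) * GammaC (b%:C - 'i%C * t%:C) =
  fourier (beta_density a b) t.
Proof.
move=> a0 b0.
have -> : b%:C - 'i%C * t%:C = b%:C + 'i%C * (- t)%:C.
  by rewrite rmorphN mulrN.
rewrite !GammaC_fourier//.
have ia := integrable_gamma_density a0; have ib := integrable_gamma_density b0.
have mc := continuous_measurable_fun (@continuous_cos R).
have ms := continuous_measurable_fun (@continuous_sin R).
have ic := integrable_mul_cos t ib; have js := integrable_mul_sin t ib.
have hc : fcos (beta_density a b) t =
    fcos (gamma_density a) t * fcos (gamma_density b) t +
    fsin (gamma_density a) t * fsin (gamma_density b) t.
  rewrite [LHS]/fcos -(gamma_density_conv t a0 b0 mc (@cos_max R)).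
  rewrite -[fcos (gamma_density b) t]/(\int[mu]_s _).
  rewrite -[fsin (gamma_density b) t]/(\int[mu]_s _) -!RintegralZl// -RintegralD//; first last.
    exact: (integrableZl measurableT _ js).
    exact: (integrableZl measurableT _ ic).
  apply: eq_Rintegral => v _.
  by have := fcos_shift v t ia; rewrite {1}/fcos => ->; ring.
have hs : fsin (beta_density a b) t =
    fsin (gamma_density a) t * fcos (gamma_density b) t -
    fcos (gamma_density a) t * fsin (gamma_density b) t.
  rewrite [LHS]/fsin -(gamma_density_conv t a0 b0 ms (@sin_max R)).
  rewrite -[fcos (gamma_density b) t]/(\int[mu]_s _).
  rewrite -[fsin (gamma_density b) t]/(\int[mu]_s _) -!RintegralZl// -RintegralB//; first last.
    exact: (integrableZl measurableT _ js).
    exact: (integrableZl measurableT _ ic).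
  apply: eq_Rintegral => v _.
  by have := fsin_shift v t ia; rewrite {1}/fsin => ->; ring.
rewrite /fourier hc hs fcosN fsinN//.
have mulC_conj (x y z w : R) :
    (x +i* y) * (z +i* - w) = (x * z + y * w) +i* (y * z - x * w).
  by apply/eqP; rewrite eq_complex /=; apply/andP; split; apply/eqP; ring.
exact: mulC_conj.
Qed.

End gamma.

(** * Stirling numbers of the second kind *)

Lemma leq_card_partition (T : finType) (P : {set {set T}}) :
  finset.partition P [set: T]%SET -> (#|P| <= #|T|)%N.
Proof.
move=> partP; rewrite -finset.cardsT (finset.card_partition partP) -sum1_card.
apply: leq_sum => B BP; rewrite card_gt0.
by have [_ _ P0] := and3P partP; apply: contraNneq P0 => <-.
Qed.

(** A function whose fibres are the blocks of P is the same thing as an injective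
    function on the blocks. *)
Lemma card_ffun_kernel (T X : finType) (P : {set {set T}}) :
  finset.partition P [set: T]%SET ->
  #|[set f : {ffun T -> X} | finset.preim_partition f [set: T]%SET == P]%SET| =
  #|X| ^_ #|P|.
Proof.
move=> partP; have [/eqP covP tiP P0] := and3P partP.
pose aT := {B : {set T} | B \in P}.
have blkP i : finset.pblock P i \in P by apply: finset.pblock_mem; rewrite covP inE.
pose blk i : aT := exist _ (finset.pblock P i) (blkP i).
have memblk i : i \in finset.pblock P i by rewrite finset.mem_pblock covP inE.
have rep (B : aT) : {i | i \in val B}.
  apply: sigW; apply/finset.set0Pn; apply: contraNneq P0 => <-; exact: valP.
have repK (B : aT) : blk (sval (rep B)) = B.
  by apply: val_inj; apply: (finset.def_pblock tiP) (valP B) (svalP (rep B)).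
pose lift (g : {ffun aT -> X}) : {ffun T -> X} := [ffun i => g (blk i)].
have lift_inj : injective lift.
  move=> g h /ffunP gh; apply/ffunP => B.
  by have := gh (sval (rep B)); rewrite !ffunE repK.
have -> : #|P| = #|{: aT}| by rewrite card_sig.
rewrite -card_inj_ffuns -(finset.card_imset _ lift_inj); apply: eq_card => f.
rewrite inE; apply/eqP/finset.imsetP => [kerf|[g]]; last first.
  rewrite inE => /injectiveP g_inj ->.
  rewrite -[RHS](finset.preim_partition_pblock partP).
  apply: finset.eq_imset => x; apply/setP => y; rewrite !inE !ffunE.
  by rewrite (inj_eq g_inj) -val_eqE.
have kerE x y : (y \in finset.pblock P x) = (f x == f y).
  rewrite -kerf finset.pblock_equivalence_partition ?inE//.
  by split=> // /eqP ->.
exists [ffun B : aT => f (sval (rep B))]; last first.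
  apply/ffunP => i; rewrite !ffunE; apply/eqP; rewrite -kerE.
  exact: (svalP (rep (blk i))).
rewrite inE; apply/injectiveP => B C; rewrite !ffunE => /eqP.
rewrite -kerE => BC; rewrite -[B]repK -[C]repK; apply: val_inj => /=.
by rewrite (finset.same_pblock tiP BC).
Qed.

(** Count all functions from a k-set to an x-set by their partition into fibres. *)
Lemma sum_stirling2_ffact k x : (\sum_(m < k.+1) stirling2 k m * x ^_ m = x ^ k)%N.
Proof.
have -> : (x ^ k)%N = #|{: {ffun 'I_k -> 'I_x}}| by rewrite card_ffun !card_ord.
rewrite -sum1_card; symmetry.
pose ker (f : {ffun 'I_k -> 'I_x}) := finset.preim_partition f [set: 'I_k]%SET.
rewrite (partition_big ker (fun P => finset.partition P [set: 'I_k]%SET)) => [|f _]; last first.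
  exact: finset.preim_partitionP.
rewrite (partition_big (fun P : {set {set 'I_k}} => inord #|P| : 'I_k.+1) xpredT)//=.
apply: eq_bigr => m _.
(* A partition of a k-set has at most k blocks, so [inord] is faithful here. *)
have leP (P : {set {set 'I_k}}) : finset.partition P [set: 'I_k]%SET -> (#|P| < k.+1)%N.
  by move=> /leq_card_partition; rewrite ltnS card_ord.
rewrite (eq_bigr (fun=> x ^_ m)) => [|P /andP[partP /eqP Pm]]; last first.
  rewrite -[in RHS]Pm inordK ?leP//.
  rewrite -[in RHS](card_ord x) -(card_ffun_kernel _ partP) -sum1_card.
  by apply: eq_bigl => f; rewrite !inE.
rewrite sum_nat_const; congr (_ * _)%N; rewrite /stirling2; apply: eq_card => P.
rewrite !inE [in LHS]unfold_in/=.
case: (boolP (finset.partition _ _)) => //= partP.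
by rewrite -val_eqE/= inordK ?leP.
Qed.

(** The falling factorials are triangular: at x = m the terms of index above m
    vanish and the one of index m is m! times its coefficient. *)
Lemma ffact_coef_uniq N (c d : nat -> nat) :
  (forall x, \sum_(m < N) c m * x ^_ m = \sum_(m < N) d m * x ^_ m)%N ->
  forall m, (m < N)%N -> c m = d m.
Proof.
move=> cd; elim/ltn_ind => m IH mN.
have := cd m; pose m0 := Ordinal mN.
rewrite (bigD1 m0)//= [RHS](bigD1 m0)//=.
rewrite (eq_bigr (fun i : 'I_N => d i * m ^_ i)%N).
  move/addIn/eqP; rewrite eqn_pmul2r ?ffact_gt0//; exact/eqP.
move=> i; rewrite -val_eqE/= neq_ltn => /orP[im|mi]; first by rewrite IH.
by rewrite ffact_small// !muln0.
Qed.

Lemma stirling2_small k m : (k < m)%N -> stirling2 k m = 0%N.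
Proof.
move=> km; apply: eq_card0 => P; rewrite !inE; apply/negP => /andP[partP /eqP Pm].
by move: km; rewrite ltnNge -Pm -[k in (_ <= k)%N]card_ord leq_card_partition.
Qed.

(** Multiply the expansion of x^k in falling factorials by x, use
    x (x)_m = m (x)_m + (x)_(m+1), and compare coefficients with the expansion of
    x^(k+1). *)
Lemma stirling2_rec k m :
  stirling2 k.+1 m.+1 = (m.+1 * stirling2 k m.+1 + stirling2 k m)%N.
Proof.
(* The coefficients of x * x^k. *)
pose c m := if m is m'.+1 then (m * stirling2 k m + stirling2 k m')%N else 0%N.
have [km|mk] := ltnP k m.
  by rewrite !stirling2_small ?muln0//; exact: ltnW.
apply: (@ffact_coef_uniq k.+2 (stirling2 k.+1) c); last by rewrite !ltnS.
move=> x; rewrite sum_stirling2_ffact expnS -sum_stirling2_ffact.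
rewrite big_distrr/= [RHS]big_ord_recl mul0n add0n.
rewrite (eq_bigr (fun m : 'I_k.+1 => m * stirling2 k m * x ^_ m + stirling2 k m * x ^_ m.+1)%N).
  rewrite [RHS](eq_bigr (fun m : 'I_k.+1 => m.+1 * stirling2 k m.+1 * x ^_ m.+1 + stirling2 k m * x ^_ m.+1)%N).
    rewrite !big_split/=; congr (_ + _)%N.
    rewrite big_ord_recl !mul0n add0n [RHS]big_ord_recr/= stirling2_small//.
    by rewrite muln0 mul0n addn0.
  by move=> i _; rewrite /c/= mulnDl.
move=> i _; rewrite ffactnSr.
have [ix|xi] := leqP i x; last by rewrite ffact_small// !mul0n !muln0.
by rewrite -{1}(subnKC ix) mulnDl mulnA; congr (_ + _)%N; rewrite mulnC mulnA.
Qed.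

(** * Iterated derivatives *)

Section leibniz.
Context (R : realType).
Implicit Types (f g : R -> R).

Lemma expdecayZ (r : R) f : expdecay f -> expdecay (fun s => r * f s).
Proof.
move=> [K [c [c0 fK]]]; exists (`|r| * K), c; split=> // s.
by rewrite normrM -mulrA ler_wpM2l.
Qed.

Lemma expdecayD f g : expdecay f -> expdecay g -> expdecay (fun s => f s + g s).
Proof.
move=> [K [c [c0 fK]]] [L [d [d0 gL]]].
exists (`|K| + `|L|), (Num.min c d); split=> [|s]; first by rewrite lt_min c0.
rewrite (le_trans (ler_normD _ _))// mulrDl lerD//.
- rewrite (le_trans (fK s))// (le_trans (ler_wpM2r (expR_ge0 _) (ler_norm K)))//.
  by rewrite ler_wpM2l// ler_expR lerN2 ler_wpM2r// ge_min lexx.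
- rewrite (le_trans (gL s))// (le_trans (ler_wpM2r (expR_ge0 _) (ler_norm L)))//.
  by rewrite ler_wpM2l// ler_expR lerN2 ler_wpM2r// ge_min lexx orbT.
Qed.

Lemma expdecay_sum n (F : 'I_n -> R -> R) : (forall i, expdecay (F i)) ->
  expdecay (fun s => \sum_(i < n) F i s).
Proof.
elim: n F => [|n IH] F dF.
  exists 0, 1; split=> // s; by rewrite big_ord0 normr0 mul0r.
under eq_fun do rewrite big_ord_recl.
by apply: expdecayD => //; exact: IH.
Qed.

Lemma is_derive_fun_sum n (F : 'I_n -> R -> R) (dF : 'I_n -> R) (x : R) :
  (forall i, is_derive x 1 (F i) (dF i)) ->
  is_derive x 1 (fun s => \sum_(i < n) F i s) (\sum_(i < n) dF i).
Proof.
move=> h; rewrite (_ : (fun s => _) = \sum_(i < n) F i); last first.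
  by apply/funext => s; rewrite fct_sumE.
exact: is_derive_sum.
Qed.

Variables (a : R) (phi : nat -> R -> R).
Hypothesis dphi : forall m (x : R),
  is_derive x 1 (phi m) ((a + m%:R) * phi m x - phi m.+1 x).
Hypothesis decay_phi : forall m, expdecay (phi m).

(** The model is phi m s = (-1)^m e^((a + m) s) f^(m)(e^s), which satisfies the
    rule [dphi].  Then [stirling_sum k] is e^(as) times the k-th derivative of
    f(e^s), and [leibniz_sum n] is the n-th derivative of e^(as) f(e^s) by
    Leibniz's formula. *)
Definition stirling_sum k (s : R) : R :=
  \sum_(m < k.+1) (stirling2 k m)%:R * (-1) ^+ m * phi m s.

Definition leibniz_sum n (s : R) : R :=
  \sum_(k < n.+1) 'C(n, k)%:R * a ^+ (n - k) * stirling_sum k s.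

(** Differentiating phi m yields m phi m and - phi m.+1; collecting the
    coefficient of each phi reproduces the recurrence of the Stirling
    numbers. *)
Lemma is_derive_stirling_sum k (x : R) :
  is_derive x 1 (stirling_sum k) (a * stirling_sum k x + stirling_sum k.+1 x).
Proof.
have dF (m : 'I_k.+1) :
    is_derive x 1 (fun s => (stirling2 k m)%:R * (-1) ^+ m * phi m s)
      ((stirling2 k m)%:R * (-1) ^+ m * ((a + m%:R) * phi m x - phi m.+1 x)).
  by have d := dphi m; apply: is_derive_eq; rewrite /GRing.scale.
apply: (is_derive_eq (is_derive_fun_sum dF)).
rewrite /stirling_sum [X in _ = _ + X]big_ord_recl/= stirling2_S0 !mul0r add0r.
rewrite (eq_bigr (fun m : 'I_k.+1 => a * ((stirling2 k m)%:R * (-1) ^+ m * phi m x) +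
   (m%:R * (stirling2 k m)%:R * (-1) ^+ m * phi m x +
    (stirling2 k m)%:R * (-1) ^+ m.+1 * phi m.+1 x))); last first.
  by move=> m _; rewrite exprS; ring.
rewrite big_split/= -big_distrr/=; congr (_ + _).
rewrite [RHS](eq_bigr (fun m : 'I_k.+1 =>
  m.+1%:R * (stirling2 k m.+1)%:R * (-1) ^+ m.+1 * phi m.+1 x +
  (stirling2 k m)%:R * (-1) ^+ m.+1 * phi m.+1 x)); last first.
  by move=> m _; rewrite stirling2_rec natrD natrM; ring.
rewrite !big_split/=; congr (_ + _).
rewrite big_ord_recl !mul0r add0r [RHS]big_ord_recr/= stirling2_small//.
by rewrite mulr0 !mul0r addr0.
Qed.

(** Pascal's rule. *)
Lemma is_derive_leibniz_sum n (x : R) :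
  is_derive x 1 (leibniz_sum n) (leibniz_sum n.+1 x).
Proof.
have dF (k : 'I_n.+1) :
    is_derive x 1 (fun s => 'C(n, k)%:R * a ^+ (n - k) * stirling_sum k s)
      ('C(n, k)%:R * a ^+ (n - k) * (a * stirling_sum k x + stirling_sum k.+1 x)).
  by have d := is_derive_stirling_sum k; apply: is_derive_eq; rewrite /GRing.scale.
apply: (is_derive_eq (is_derive_fun_sum dF)).
rewrite /leibniz_sum.
rewrite (eq_bigr (fun k : 'I_n.+1 => 'C(n, k)%:R * a ^+ (n.+1 - k) * stirling_sum k x +
   'C(n, k)%:R * a ^+ (n - k) * stirling_sum k.+1 x)); last first.
  by move=> k _; rewrite subSn ?leq_ord// exprS; ring.
rewrite big_split/= [in RHS]big_ord_recl/= bin0.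
rewrite [X in _ = _ + X](eq_bigr (fun k : 'I_n.+1 =>
   'C(n, k.+1)%:R * a ^+ (n - k) * stirling_sum k.+1 x +
   'C(n, k)%:R * a ^+ (n - k) * stirling_sum k.+1 x)); last first.
  by move=> k _; rewrite /bump/= add1n binS natrD subSS; ring.
rewrite big_split/= addrA; congr (_ + _).
by rewrite [in LHS]big_ord_recl/= bin0 [in RHS]big_ord_recr/= bin_small// !mul0r addr0.
Qed.

Lemma decay_chain_leibniz : decay_chain leibniz_sum.
Proof.
move=> n; split; last exact: is_derive_leibniz_sum.
by apply: expdecay_sum => k; apply: expdecayZ; apply: expdecay_sum => m; exact: expdecayZ.
Qed.

Lemma leibniz_sum0 : leibniz_sum 0 = phi 0.
Proof.
apply/funext => s; rewrite /leibniz_sum /stirling_sum !big_ord1 stirling2_00.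
by rewrite bin0 !expr0 !mul1r.
Qed.

End leibniz.

Section beta_family.
Context (R : realType).
Implicit Types (a b s x : R).

Lemma is_derive_beta_density a b x : 0 < a -> 0 < b ->
  is_derive x 1 (beta_density a b)
    (a * beta_density a b x - beta_density (a + 1) b x).
Proof.
move=> a0 b0; have e0 := oneDexpR_gt0 x.
have dl : is_derive x 1 (fun s => ln (1 + expR s)) ((1 + expR x)^-1 * expR x).
  have h := is_derive1_ln e0.
  by apply: is_derive_eq; rewrite /GRing.scale/= add0r mul1r.
rewrite /beta_density; apply: is_derive_eq; rewrite /GRing.scale/=.
rewrite (_ : a + 1 + b = a + b + 1); last ring.
rewrite gammaRS ?addr_gt0//.
rewrite (_ : (a + 1) * x - (a + b + 1) * ln (1 + expR x) =
  (a * x - (a + b) * ln (1 + expR x)) + (x - ln (1 + expR x))); last ring.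
rewrite (expRD (a * x - (a + b) * ln (1 + expR x))) (expRB x) lnK ?posrE//.
ring.
Qed.

(** The exponent a s - (a + b) ln(1 + e^s) is at most a s, and at most - b s since
    ln(1 + e^s) >= s. *)
Lemma expdecay_beta_density a b : 0 < a -> 0 < b -> expdecay (beta_density a b).
Proof.
move=> a0 b0; apply: expdecayZ.
exists 1, (Num.min a b); split=> [|s]; first by rewrite lt_min a0.
rewrite mul1r ger0_norm ?expR_ge0// ler_expR.
have [s0|s0] := leP 0 s.
  have h : s <= ln (1 + expR s).
    by rewrite -{1}(expRK s) ler_ln ?posrE ?expR_gt0 ?oneDexpR_gt0// lerDr.
  rewrite (le_trans (lerB (lexx _) (ler_wpM2l (ltW (addr_gt0 a0 b0)) h)))//.
  rewrite -subr_ge0 ger0_norm// (_ : _ - _ = (b - Num.min a b) * s); last ring.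
  by rewrite mulr_ge0// subr_ge0 ge_min lexx orbT.
have h : 0 <= ln (1 + expR s) by rewrite ln_ge0// lerDl expR_ge0.
rewrite ltr0_norm// mulrN opprK.
rewrite (le_trans (_ : _ <= a * s))//; first by rewrite gerBl mulr_ge0// ltW// addr_gt0.
by rewrite ler_nM2r// ge_min lexx.
Qed.

End beta_family.

(** * Moments *)

Section moments.
Context (R : realType).

Lemma gamma_moment (a lambda : R) (ha : 0 < a) (n : nat) :
  has_integralC [set: R]
        (fun t => expC (- 'i%C * lambda%:C * t%:C) * t%:C ^+ n *
                  GammaC (a%:C + 'i%C * t%:C))
        ('i%C ^+ n * (2 * pi)%:C * (expR (a * lambda))%:C *
         (expR (- expR lambda))%:C *
         \sum_(0 <= k < n.+1) 'C(n, k)%:R * a%:C ^+ (n - k) *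
           \sum_(0 <= m < k.+1)
             (stirling2 k m)%:R * (-1) ^+ m * (expR (lambda * m%:R))%:C).
Proof.
pose phi (m : nat) := gamma_density (a + m%:R).
have am m : 0 < a + m%:R by rewrite ltr_wpDr.
have dphi m (x : R) : is_derive x 1 (phi m) ((a + m%:R) * phi m x - phi m.+1 x).
  by rewrite /phi -natr1 addrA; exact: is_derive_gamma_density.
have cg := decay_chain_leibniz dphi (fun m => expdecay_gamma_density (am m)).
have := fourier_moment cg n lambda.
rewrite leibniz_sum0 /phi addr0.
under eq_fun do rewrite -(GammaC_fourier _ ha).
congr (has_integralC _ _ _).
have -> : \sum_(0 <= k < n.+1) 'C(n, k)%:R * a%:C ^+ (n - k) *
    \sum_(0 <= m < k.+1) (stirling2 k m)%:R * (-1) ^+ m * (expR (lambda * m%:R))%:C =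
  (\sum_(k < n.+1) 'C(n, k)%:R * a ^+ (n - k) *
    \sum_(m < k.+1) (stirling2 k m)%:R * (-1) ^+ m * expR (lambda * m%:R))%:C.
  rewrite big_mkord rmorph_sum; apply: eq_bigr => k _.
  rewrite big_mkord !rmorphM rmorph_nat rmorphXn rmorph_sum.
  congr (_ * _); apply: eq_bigr => m _.
  by rewrite !rmorphM rmorph_nat rmorphXn rmorphN rmorph1.
rewrite -!mulrA -!rmorphM -!mulrA; congr (_ * (_ * (_ * _))%:C).
rewrite /leibniz_sum !mulr_sumr; apply: eq_bigr => k _.
rewrite /stirling_sum !mulr_sumr; apply: eq_bigr => m _.
have -> : gamma_density (a + m%:R) lambda =
    expR (a * lambda) * expR (- expR lambda) * expR (lambda * m%:R).
  by rewrite /gamma_density -!expRD; congr expR; ring.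
ring.
Qed.

Lemma beta_moment (a b mu : R) (ha : 0 < a) (hb : 0 < b) (n : nat) :
  has_integralC [set: R]
        (fun t => expC (- 'i%C * mu%:C * t%:C) * t%:C ^+ n *
                  GammaC (a%:C + 'i%C * t%:C) * GammaC (b%:C - 'i%C * t%:C))
        ('i%C ^+ n * (2 * pi)%:C * (expR (- b * mu))%:C *
         \sum_(0 <= k < n.+1) \sum_(0 <= m < k.+1)
           'C(n, k)%:R * (stirling2 k m)%:R * (-1) ^+ m * a%:C ^+ (n - k) *
           (GammaC (a + b + m%:R)%:C /
            ((1 + expR (- mu)) `^ (a + b + m%:R))%:C)).
Proof.
pose phi (m : nat) := beta_density (a + m%:R) b.
have am m : 0 < a + m%:R by rewrite ltr_wpDr.
have dphi m (x : R) : is_derive x 1 (phi m) ((a + m%:R) * phi m x - phi m.+1 x).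
  by rewrite /phi -natr1 addrA; exact: is_derive_beta_density.
have cg := decay_chain_leibniz dphi (fun m => expdecay_beta_density (am m) hb).
have := fourier_moment cg n mu.
rewrite leibniz_sum0 /phi addr0.
under eq_fun do rewrite -(GammaC_mul_fourier _ ha hb) mulrA.
congr (has_integralC _ _ _).
have -> : \sum_(0 <= k < n.+1) \sum_(0 <= m < k.+1)
           'C(n, k)%:R * (stirling2 k m)%:R * (-1) ^+ m * a%:C ^+ (n - k) *
           (GammaC (a + b + m%:R)%:C /
            ((1 + expR (- mu)) `^ (a + b + m%:R))%:C) =
   (\sum_(k < n.+1) \sum_(m < k.+1)
           'C(n, k)%:R * (stirling2 k m)%:R * (-1) ^+ m * a ^+ (n - k) *
           (gammaR (a + b + m%:R) / (1 + expR (- mu)) `^ (a + b + m%:R)))%:C.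
  rewrite big_mkord rmorph_sum; apply: eq_bigr => k _.
  rewrite big_mkord rmorph_sum; apply: eq_bigr => m _.
  rewrite GammaC_gammaR; last by rewrite ltr_wpDr// addr_gt0.
  by rewrite !rmorphM !rmorph_nat !rmorphXn rmorphN rmorph1 fmorphV !mulrA.
rewrite -!mulrA -!rmorphM -!mulrA; congr (_ * (_ * (_ * _))%:C).
rewrite /leibniz_sum mulr_sumr; apply: eq_bigr => k _.
rewrite /stirling_sum !mulr_sumr; apply: eq_bigr => m _.
have -> : beta_density (a + m%:R) b mu = expR (- b * mu) *
    (gammaR (a + b + m%:R) / (1 + expR (- mu)) `^ (a + b + m%:R)).
  have e0 := oneDexpR_gt0 mu.
  (* ln(1 + e^(-mu)) = ln(1 + e^mu) - mu *)
  have -> : 1 + expR (- mu) = expR (ln (1 + expR mu) - mu).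
    by rewrite expRB lnK ?posrE// mulrDl mul1r mulfV ?gt_eqF ?expR_gt0// -expRN addrC.
  rewrite /beta_density -expRM -expRN mulrCA -expRD addrAC.
  by congr (_ * expR _); ring.
ring.
Qed.

Lemma expC_mul0 (t : R) : expC (- 'i%C * 0%:C * t%:C) = 1.
Proof.
have -> : - 'i%C * 0%:C * t%:C = 0 :> R[i] by rewrite mulr0 mul0r.
by rewrite /expC /= expR0 cos0 sin0 mul1r.
Qed.

End moments.

Unset Implicit Arguments.

Theorem proposition6 (R : realType) (a b lambda mu : R)
    (ha : 0 < a) (hb : 0 < b) (n : nat) :
  [/\ has_integralC [set: R]
        (fun t => expC (- 'i%C * mu%:C * t%:C) * t%:C ^+ n *
                  GammaC (a%:C + 'i%C * t%:C) * GammaC (b%:C - 'i%C * t%:C))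
        ('i%C ^+ n * (2 * pi)%:C * (expR (- b * mu))%:C *
         \sum_(0 <= k < n.+1) \sum_(0 <= m < k.+1)
           'C(n, k)%:R * (stirling2 k m)%:R * (-1) ^+ m * a%:C ^+ (n - k) *
           (GammaC (a + b + m%:R)%:C /
            ((1 + expR (- mu)) `^ (a + b + m%:R))%:C)),
      has_integralC [set: R]
        (fun t => expC (- 'i%C * lambda%:C * t%:C) * t%:C ^+ n *
                  GammaC (a%:C + 'i%C * t%:C))
        ('i%C ^+ n * (2 * pi)%:C * (expR (a * lambda))%:C *
         (expR (- expR lambda))%:C *
         \sum_(0 <= k < n.+1) 'C(n, k)%:R * a%:C ^+ (n - k) *
           \sum_(0 <= m < k.+1)
             (stirling2 k m)%:R * (-1) ^+ m * (expR (lambda * m%:R))%:C),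
      has_integralC [set: R]
        (fun t => t%:C ^+ n *
                  GammaC (a%:C + 'i%C * t%:C) * GammaC (b%:C - 'i%C * t%:C))
        ('i%C ^+ n * pi%:C *
         \sum_(0 <= k < n.+1) \sum_(0 <= m < k.+1)
           'C(n, k)%:R * (stirling2 k m)%:R * (-1) ^+ m * a%:C ^+ (n - k) *
           (GammaC (a + b + m%:R)%:C / (2 `^ (a + b + m%:R - 1))%:C))
    & has_integralC [set: R]
        (fun t => t%:C ^+ n * GammaC (a%:C + 'i%C * t%:C))
        ((2 * pi)%:C * 'i%C ^+ n / (expR 1)%:C *
         \sum_(0 <= k < n.+1) \sum_(0 <= m < k.+1)
           'C(n, k)%:R * (stirling2 k m)%:R * (-1) ^+ m * a%:C ^+ (n - k))].
Proof.
split.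
- exact: beta_moment.
- exact: gamma_moment.
- have := beta_moment 0 ha hb n.
  under eq_fun do rewrite expC_mul0 mul1r.
  congr (has_integralC _ _ _).
  rewrite mulr0 oppr0 expR0 mulr1 -!mulrA; congr (_ * _).
  rewrite rmorphM [X in X * _]mulrC -mulrA; congr (_ * _).
  rewrite mulr_sumr; apply: eq_bigr => k _; rewrite mulr_sumr; apply: eq_bigr => m _.
  (* The powers of 2 differ by the factor 2 of 2 pi. *)
  have -> : 2 `^ (a + b + m%:R - 1) = 2^-1 * (1 + 1) `^ (a + b + m%:R) :> R.
    by rewrite powRD ?pnatr_eq0 ?implybT// powR_inv1// mulrC.
  by rewrite rmorphM invfM fmorphV invrK; ring.
- have := gamma_moment 0 ha n.
  under eq_fun do rewrite expC_mul0 mul1r.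
  congr (has_integralC _ _ _).
  rewrite mulr0 expR0 mulr1 expRN fmorphV [_ * (2 * pi)%:C]mulrC; congr (_ * _).
  apply: eq_bigr => k _; rewrite mulr_sumr; apply: eq_bigr => m _.
  rewrite mul0r expR0 mulr1; ring.
Qed.
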